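(* Let $k=\mathbb{C}$ and let $S$ be a discrete bounded semilattice. Then there exist a biideal $I\subseteq kS$ and an isomorphism of bialgebras $\mathrm{Rep}(\widehat{S})\cong kS/I$. In particular, if $S$ is finite, then $\mathrm{Rep}(\widehat{S})\cong kS$ as bialgebras.
   Context: A bounded semilattice is a semilattice (a partially ordered set in which any two elements have a greatest lower bound, with product $st=\mathrm{glb}\{s,t\}$, or dually least upper bounds) which is a monoid under this product; equivalently, a commutative monoid in which every element is idempotent. Discrete means endowed with the discrete topology. Let $\mathbb{T}=\{z\in\mathbb{C}\mid |z|=1\}$ and $\mathbb{B}=\mathbb{T}\cup\{0\}$, a compact abelian topological monoid under multiplication. The Pontryagin dual of a topological monoid $S$ is $\widehat{S}=\{\chi:S\to\mathbb{B}\mid\chi\text{ a continuous monoid homomorphism}\}$, a monoid under pointwise multiplication; for $S$ discrete it is given the topology of a subspace of the product $\prod_{s\in S}\mathbb{B}$ via $\chi\mapsto(\chi(s))_{s\in S}$. For a topological monoid $T$, a continuous function $f:T\to k$ is representative if the linear span of its left translates $y\mapsto f(zy)$, $z\in T$, is finite dimensional; $\mathrm{Rep}(T)$ is the space of all continuous representative functions on $T$. It is a $k$-bialgebra with pointwise algebra operations, coproduct determined by $\Delta(f)(s,t)=f(st)$ and counit $\epsilon(f)=f(e)$, where $e$ is the identity of $T$. The monoid algebra $kS$ is a bialgebra with $\Delta(s)=s\otimes s$ and $\epsilon(s)=1$ for $s\in S$. A biideal of a bialgebra is a subspace that is both a two-sided ideal and a coideal (a subspace $I$ of a coalgebra $C$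 is a coideal if $\Delta(I)\subseteq I\otimes C+C\otimes I$ and $\epsilon(I)=0$). *)

(* Defs.v *)
From HB Require Import structures.
From mathcomp Require Import all_boot all_order all_algebra.
From mathcomp Require Import finmap monalg generic_quotient ring_quotient.
From mathcomp Require Import all_classical all_reals all_analysis.
From mathcomp Require Import complex.

Set Implicit Arguments.
Unset Strict Implicit.
Unset Printing Implicit Defensive.

Import GRing.Theory Num.Theory.
Import numFieldNormedType.Exports.

Local Open Scope classical_set_scope.
Local Open Scope ring_scope.
Local Open Scope quotient_scope.

Section Linear.
Variables (k : fieldType) (U V : lmodType k) (f : U -> V).
Hypothesis linf : linear f.

Lemma lin0 : f 0 = 0.
Proof. by rewrite -[X in f X](addNr 0) -scaleN1r linf scaleN1r addNr. Qed.

Lemma linD u v : f (u + v) = f u + f v.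
Proof. by rewrite -[u]scale1r linf !scale1r. Qed.

Lemma linZ a u : f (a *: u) = a *: f u.
Proof. by rewrite -[a *: u]addr0 linf lin0 addr0. Qed.

Lemma linB u v : f (u - v) = f u - f v.
Proof. by rewrite linD -scaleN1r linZ scaleN1r. Qed.

Lemma lin_sum (I : Type) (r : seq I) (F : I -> U) :
  f (\sum_(i <- r) F i) = \sum_(i <- r) f (F i).
Proof. exact: (big_morph f linD lin0). Qed.

End Linear.

Section Subspaces.
Variables (k : fieldType) (V : lmodType k).
Implicit Types (W : set V) (a : k) (u v : V).

Definition is_vsubspace W := W 0 /\ forall a u v, W u -> W v -> W (a *: u + v).

Definition linear_span (A : set V) : set V := smallest is_vsubspace A.

Definition finite_dimensional W := exists s : seq V, W = linear_span [set` s].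

Record vsubspace := VSubspace { vsubspace_pred :> V -> Prop; _ : is_vsubspace vsubspace_pred }.

Lemma subspaceP (N : vsubspace) : is_vsubspace N. Proof. by case: N. Qed.

Lemma subspaceD W u v : is_vsubspace W -> W u -> W v -> W (u + v).
Proof. by move=> [_ sW] Wu Wv; rewrite -[u]scale1r; exact: sW. Qed.

Lemma subspaceZ W a u : is_vsubspace W -> W u -> W (a *: u).
Proof. by move=> [W0 sW] Wu; rewrite -[a *: u]addr0; exact: sW. Qed.

Lemma subspaceB W u v : is_vsubspace W -> W u -> W v -> W (u - v).
Proof.
by move=> sW Wu Wv; rewrite -scaleN1r; apply: subspaceD => //; exact: subspaceZ.
Qed.

Lemma subspace_sum W (I : eqType) (r : seq I) (F : I -> V) :
  is_vsubspace W -> (forall i, i \in r -> W (F i)) -> W (\sum_(i <- r) F i).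
Proof.
move=> sW WF; rewrite big_seq; elim/big_ind: _ => //; first by case: sW.
by move=> *; exact: subspaceD.
Qed.

Lemma span_subspace (A : set V) : is_vsubspace (linear_span A).
Proof.
split=> [W [[W0 _] _] //|a u v Au Av W WA].
by case: (WA) => -[_ sW] _; apply: sW; [exact: Au | exact: Av].
Qed.

Lemma sub_span (A : set V) : A `<=` linear_span A.
Proof. exact: sub_smallest. Qed.

Lemma span_sub (A W : set V) : is_vsubspace W -> A `<=` W -> linear_span A `<=` W.
Proof. by move=> sW AW; exact: smallest_sub. Qed.

Lemma span_mono (A B : set V) : A `<=` B -> linear_span A `<=` linear_span B.
Proof.
move=> AB; apply: span_sub; first exact: span_subspace.
by apply: subset_trans AB _; exact: sub_span.
Qed.

Definition subspace_span (A : set V) := VSubspace (span_subspace A).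

End Subspaces.

Lemma preimage_subspace (k : fieldType) (U V : lmodType k) (f : U -> V)
  (W : set V) : linear f -> is_vsubspace W -> is_vsubspace (f @^-1` W).
Proof.
move=> lf sW; split=> [|a u v /= Wu Wv] /=; first by rewrite (lin0 lf); case: sW.
by rewrite lf; case: sW => _; apply.
Qed.

Lemma span_linear (k : fieldType) (U V : lmodType k) (f : U -> V) (A : set U)
  (W : set V) : linear f -> is_vsubspace W -> (forall x, A x -> W (f x)) ->
  forall x, linear_span A x -> W (f x).
Proof. by move=> lf sW AW; apply: span_sub => //; exact: preimage_subspace. Qed.

Lemma kernel_subspace (k : fieldType) (U V : lmodType k) (f : U -> V) :
  linear f -> is_vsubspace [set x | f x = 0].
Proof.
move=> lf; split=> [|a u v /= fu fv]; first exact: lin0.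
by rewrite lf fu fv scaler0 addr0.
Qed.

Section QuotientSpace.
Variables (k : fieldType) (V : lmodType k) (N : vsubspace V).

Definition subspace_mem : {pred V} := fun x => `[< N x >].

Lemma subspace_mem_closed : zmod_closed subspace_mem.
Proof.
split=> [|u v /asboolP Nu /asboolP Nv]; apply/asboolP.
  by case: (subspaceP N).
by apply: subspaceB => //; exact: subspaceP.
Qed.

HB.instance Definition _ := GRing.isZmodClosed.Build V subspace_mem
  subspace_mem_closed.

Definition quotient_space := Quotient.quot subspace_mem.

HB.instance Definition _ := GRing.Zmodule.on quotient_space.

Definition qproj (v : V) : quotient_space := \pi_(Quotient.quot subspace_mem) v.
Definition qrepr (q : quotient_space) : V := repr q.

Lemma qreprK : cancel qrepr qproj. Proof. exact: reprK. Qed.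

Lemma qproj_eq u v : qproj u = qproj v <-> N (u - v).
Proof.
rewrite /qproj; split=> [/eqP|Nuv].
  by rewrite -Quotient.idealrBE => /asboolP.
by apply/eqP; rewrite -Quotient.idealrBE; apply/asboolP.
Qed.

Lemma qprojD u v : qproj (u + v) = qproj u + qproj v.
Proof. exact: (raddfD (\pi_(Quotient.quot subspace_mem))). Qed.

Definition qscale (a : k) (q : quotient_space) := qproj (a *: qrepr q).

Lemma qscaleE a v : qscale a (qproj v) = qproj (a *: v).
Proof.
apply/qproj_eq; rewrite -scalerBr; apply: subspaceZ; first exact: subspaceP.
by apply/qproj_eq; rewrite qreprK.
Qed.

Lemma qscaleA a b v : qscale a (qscale b v) = qscale (a * b) v.
Proof. by rewrite -[v]qreprK !qscaleE scalerA. Qed.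
Lemma qscale1 : left_id 1 qscale.
Proof. by move=> v; rewrite -[v]qreprK qscaleE scale1r. Qed.
Lemma qscaleDr : right_distributive qscale +%R.
Proof.
move=> a u v; rewrite -[u]qreprK -[v]qreprK -qprojD !qscaleE scalerDr.
exact: qprojD.
Qed.
Lemma qscaleDl v : {morph qscale^~ v : a b / a + b}.
Proof. by move=> a b; rewrite -[v]qreprK !qscaleE scalerDl qprojD. Qed.

HB.instance Definition _ := GRing.Zmodule_isLmodule.Build k quotient_space
  qscaleA qscale1 qscaleDr qscaleDl.

Lemma qproj_linear : linear qproj.
Proof. by move=> a u v; rewrite qprojD -qscaleE. Qed.

Lemma qproj_surj (q : quotient_space) : exists v, q = qproj v.
Proof. by exists (qrepr q); rewrite qreprK. Qed.

Lemma qproj0 u : N u -> qproj u = 0.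
Proof. by move=> Nu; rewrite -(lin0 qproj_linear); apply/qproj_eq; rewrite subr0. Qed.

Section Factor.
Variables (U : lmodType k) (f : V -> U).
Hypotheses (linf : linear f) (f0 : forall x, N x -> f x = 0).

Lemma qreprE v : f (qrepr (qproj v)) = f v.
Proof.
apply/eqP; rewrite -subr_eq0 -linB //; apply/eqP/f0/qproj_eq.
by rewrite qreprK.
Qed.

Lemma qrepr_linear : linear (f \o qrepr).
Proof.
move=> a q r; have [[u ->] [v ->]] := (qproj_surj q, qproj_surj r).
by rewrite /= -qproj_linear !qreprE linf.
Qed.

End Factor.
End QuotientSpace.

(* Elements of {malg k[X]} are the finitely supported functions X -> k, so it is
   the free vector space on X; malg_ext f is the linear extension of f. *)
HB.lock Definition malg_ext (k : fieldType) (X : choiceType) (U : lmodType k)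
  (f : X -> U) (g : {malg k[X]}) : U := \sum_(x <- msupp g) g@_x *: f x.

Section FreeModule.
Variables (k : fieldType) (X : choiceType) (U : lmodType k).
Implicit Types (f : X -> U) (g : {malg k[X]}).

Lemma mkmalgUZ (c : k) (x : X) : << c *g x >> = c *: << x >> :> {malg k[X]}.
Proof. by apply/malgP => y; rewrite mcoeffZ !mcoeffU mulr_natr. Qed.

Lemma malg_span g : g = \sum_(x <- msupp g) g@_x *: << x >>.
Proof. by rewrite {1}[g]monalgE; apply: eq_bigr => x _; exact: mkmalgUZ. Qed.

Lemma malg_extw f g (d : {fset X}) : (msupp g `<=` d)%fset ->
  malg_ext f g = \sum_(x <- d) g@_x *: f x.
Proof.
move=> gd; rewrite unlock (big_fset_incl _ gd) //= => x _ /mcoeff_outdom ->.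
by rewrite scale0r.
Qed.

Lemma malg_ext_linear f : linear (malg_ext f).
Proof.
move=> a g h; pose d := (msupp g `|` msupp h)%fset.
rewrite (@malg_extw f g d) ?fsubsetUl // (@malg_extw f h d) ?fsubsetUr //.
rewrite (@malg_extw f _ d); last first.
  apply: fsubset_trans (msuppD_le _ _) _; apply: fsetUSS => //.
  exact: msuppZ_le.
rewrite scaler_sumr -big_split /=; apply: eq_bigr => x _.
by rewrite mcoeffD mcoeffZ scalerDl scalerA.
Qed.

Lemma malg_extU f x : malg_ext f << x >> = f x.
Proof.
by rewrite unlock msuppU oner_eq0 big_seq_fset1 mcoeffUU scale1r.
Qed.

Lemma malg_linear_eq (f1 f2 : {malg k[X]} -> U) : linear f1 -> linear f2 ->
  (forall x, f1 << x >> = f2 << x >>) -> f1 =1 f2.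
Proof.
move=> l1 l2 e g; rewrite [g]malg_span !lin_sum //; apply: eq_bigr => x _.
by rewrite !linZ // e.
Qed.

End FreeModule.

Definition bilinear_map (k : fieldType) (V W U : lmodType k) (b : V -> W -> U) : Prop :=
  (forall w, linear (b^~ w)) /\ (forall v, linear (b v)).

(* V (x) W is the free vector space on V * W modulo bilinearity. *)
Section TensorSpace.
Variables (k : fieldType) (V W : lmodType k).

Definition tensor_relations : set {malg k[(V * W)%type]} :=
  [set r | (exists a v v' w,
              r = << (a *: v + v', w) >> - (a *: << (v, w) >> + << (v', w) >>))
        \/ (exists a v w w',
              r = << (v, a *: w + w') >> - (a *: << (v, w) >> + << (v, w') >>))].

Definition tensor := quotient_space (subspace_span tensor_relations).

HB.instance Definition _ := GRing.Lmodule.on tensor.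

End TensorSpace.

HB.lock Definition tens (k : fieldType) (V W : lmodType k) (v : V) (w : W) :
  tensor V W := qproj _ << (v, w) >>.

(* tlift b evaluates b on an arbitrary representative; it is the linear map
   induced by b only when b is bilinear, see tlift_tens and tlift_linear. The
   same holds of tmap f g for linear f and g. *)
HB.lock Definition tlift (k : fieldType) (V W U : lmodType k)
  (b : V -> W -> U) (t : tensor V W) : U :=
  malg_ext (fun p => b p.1 p.2) (qrepr t).

Section Tensor.
Variables (k : fieldType) (V W : lmodType k).
Local Notation tensor := (tensor V W).
Local Notation tens := (@tens k V W).

Lemma tens_bilinear : bilinear_map tens.
Proof.
split=> [w a v v'|v a w w']; rewrite unlock -qproj_linear; apply/qproj_eq.
  by apply: sub_span; left; exists a, v, v', w.
by apply: sub_span; right; exists a, v, w, w'.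
Qed.

Lemma tensDl v v' w : tens (v + v') w = tens v w + tens v' w.
Proof. exact: (linD (proj1 tens_bilinear w)). Qed.
Lemma tensDr v w w' : tens v (w + w') = tens v w + tens v w'.
Proof. exact: (linD (proj2 tens_bilinear v)). Qed.
Lemma tensZl a v w : tens (a *: v) w = a *: tens v w.
Proof. exact: (linZ (proj1 tens_bilinear w)). Qed.
Lemma tensZr a v w : tens v (a *: w) = a *: tens v w.
Proof. exact: (linZ (proj2 tens_bilinear v)). Qed.
Lemma tens0l w : tens 0 w = 0.
Proof. exact: (lin0 (proj1 tens_bilinear w)). Qed.
Lemma tens0r v : tens v 0 = 0.
Proof. exact: (lin0 (proj2 tens_bilinear v)). Qed.

Lemma tensor_sum (t : tensor) :
  exists s : seq (V * W), t = \sum_(p <- s) tens p.1 p.2.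
Proof.
have [g ->] := qproj_surj t; rewrite [g]malg_span (lin_sum (@qproj_linear _ _ _)).
exists [seq (g@_p *: p.1, p.2) | p <- msupp g].
rewrite big_map; apply: eq_bigr => -[v w] _ /=.
by rewrite tensZl (linZ (@qproj_linear _ _ _)) [in RHS]unlock.
Qed.

Lemma tensor_ind (P : tensor -> Prop) :
  (forall v w, P (tens v w)) -> (forall s t, P s -> P t -> P (s + t)) ->
  forall t, P t.
Proof.
move=> Pt PD t; have [s ->] := tensor_sum t.
elim: s => [|p s IH]; first by rewrite big_nil -(tens0l 0).
by rewrite big_cons; exact: PD.
Qed.

Section Lift.
Variable U : lmodType k.

Lemma tensor_linear_eq (f g : tensor -> U) : linear f -> linear g ->
  (forall v w, f (tens v w) = g (tens v w)) -> f =1 g.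
Proof.
move=> lf lg fg; elim/tensor_ind => // s t es et.
by rewrite (linD lf) (linD lg) es et.
Qed.

Variable b : V -> W -> U.
Hypothesis bil : bilinear_map b.

Lemma tlift_relations x : linear_span (@tensor_relations k V W) x ->
  malg_ext (fun p => b p.1 p.2) x = 0.
Proof.
have lin := malg_ext_linear (fun p : (V * W)%type => b p.1 p.2).
move: x; apply: (span_sub (kernel_subspace lin)) => x /=.
by case=> [[a [v [v' [w ->]]]]|[a [v [w [w' ->]]]]];
  rewrite (linB lin) lin !malg_extU /= ?(proj1 bil) ?(proj2 bil) subrr.
Qed.

Lemma tlift_tens v w : tlift b (tens v w) = b v w.
Proof.
rewrite tlift.unlock tens.unlock (qreprE (malg_ext_linear _)) ?malg_extU //.
exact: tlift_relations.
Qed.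

Lemma tlift_linear : linear (tlift b).
Proof.
move=> a s t; rewrite tlift.unlock.
exact: (qrepr_linear (N := subspace_span (@tensor_relations k V W))
  (malg_ext_linear _) tlift_relations).
Qed.

End Lift.
End Tensor.

Section TensorMap.
Variables (k : fieldType) (V V' W W' : lmodType k) (f : V -> V') (g : W -> W').

Definition tmap : tensor V W -> tensor V' W' :=
  tlift (fun v w => tens (f v) (g w)).

Hypotheses (linf : linear f) (ling : linear g).

Lemma tmap_bilinear : bilinear_map (fun v w => tens (f v) (g w)).
Proof.
by split=> [w|v] a x y /=; rewrite ?linf ?ling ?tensDl ?tensDr ?tensZl ?tensZr.
Qed.

Lemma tmap_tens v w : tmap (tens v w) = tens (f v) (g w).
Proof. exact: (tlift_tens tmap_bilinear). Qed.

Lemma tmap_linear : linear tmap.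
Proof. exact: (tlift_linear tmap_bilinear). Qed.

End TensorMap.

Section TensorAssoc.
Variables (k : fieldType) (U V W : lmodType k).

Definition tassoc : tensor (tensor U V) W -> tensor U (tensor V W) :=
  tlift (fun t w => tlift (fun u v => tens u (tens v w)) t).

Lemma tassoc_bilinear1 (w : W) : bilinear_map (fun (u : U) (v : V) => tens u (tens v w)).
Proof.
by split=> [v|u] a x y /=; rewrite !(tensDl, tensDr, tensZl, tensZr).
Qed.

Lemma tassoc_bilinear :
  bilinear_map (fun t (w : W) => tlift (fun (u : U) (v : V) => tens u (tens v w)) t).
Proof.
split=> [w|t a w w'] /=; first exact: (tlift_linear (tassoc_bilinear1 w)).
elim/tensor_ind: t => [u v|s t es et].
  by rewrite !(tlift_tens (tassoc_bilinear1 _)) !(tensDr, tensZr).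
rewrite !(linD (tlift_linear (tassoc_bilinear1 _))) es et.
by rewrite scalerDr addrACA.
Qed.

Lemma tassoc_tens u v w : tassoc (tens (tens u v) w) = tens u (tens v w).
Proof.
by rewrite /tassoc (tlift_tens tassoc_bilinear) (tlift_tens (tassoc_bilinear1 _)).
Qed.

Lemma tassoc_linear : linear tassoc.
Proof. exact: (tlift_linear tassoc_bilinear). Qed.

End TensorAssoc.

Section TensorAlgebra.
Variables (k : fieldType) (A B : algType k).
Implicit Types (s t r : tensor A B).

Definition tmul s t : tensor A B :=
  tlift (fun a b => tlift (fun a' b' => tens (a * a') (b * b')) t) s.

Lemma tmul_bilinear1 (a : A) (b : B) :
  bilinear_map (fun a' b' => tens (a * a') (b * b')).
Proof.
split=> [w|v] c x y /=; rewrite mulrDr -scalerAr.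
  by rewrite tensDl tensZl.
by rewrite tensDr tensZr.
Qed.

Lemma tmul_bilinear2 t :
  bilinear_map (fun a b => tlift (fun a' b' => tens (a * a') (b * b')) t).
Proof.
split=> [w|v] c x y; elim/tensor_ind: t => [a b|s t es et].
- rewrite !(tlift_tens (tmul_bilinear1 _ _)).
  by rewrite mulrDl -scalerAl tensDl tensZl.
- rewrite !(linD (tlift_linear (tmul_bilinear1 _ _))) es et.
  by rewrite scalerDr addrACA.
- rewrite !(tlift_tens (tmul_bilinear1 _ _)).
  by rewrite mulrDl -scalerAl tensDr tensZr.
- rewrite !(linD (tlift_linear (tmul_bilinear1 _ _))) es et.
  by rewrite scalerDr addrACA.
Qed.

Lemma tmul_tens a b a' b' :
  tmul (tens a b) (tens a' b') = tens (a * a') (b * b').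
Proof.
by rewrite /tmul (tlift_tens (tmul_bilinear2 _)) (tlift_tens (tmul_bilinear1 _ _)).
Qed.

Lemma tmul_linearl t : linear (tmul^~ t).
Proof. exact: (tlift_linear (tmul_bilinear2 t)). Qed.

Lemma tmul_linearr s : linear (tmul s).
Proof.
move=> c t t'; elim/tensor_ind: s => [a b|s s' es es'].
  rewrite /tmul !(tlift_tens (tmul_bilinear2 _)).
  exact: (tlift_linear (tmul_bilinear1 a b)c t t').
by rewrite !(linD (tmul_linearl _)) es es' scalerDr addrACA.
Qed.

Lemma tmulDl : left_distributive tmul +%R.
Proof. by move=> s t r; exact: (linD (tmul_linearl r)). Qed.

Lemma tmulDr : right_distributive tmul +%R.
Proof. by move=> r s t; exact: (linD (tmul_linearr r)). Qed.

Lemma tmulA : associative tmul.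
Proof.
elim/tensor_ind=> [a b|s s' es es'] t r; last by rewrite !tmulDl es es'.
elim/tensor_ind: t => [a' b'|t t' et et']; last by rewrite tmulDl !tmulDr tmulDl et et'.
elim/tensor_ind: r => [a'' b''|r r' er er']; last by rewrite !tmulDr er er'.
by rewrite !tmul_tens !mulrA.
Qed.

Lemma tmul1 : left_id (tens 1 1) tmul.
Proof.
by elim/tensor_ind=> [a b|s t es et]; rewrite ?tmul_tens ?mul1r ?tmulDr ?es ?et.
Qed.

Lemma tmulr1 : right_id (tens 1 1) tmul.
Proof.
by elim/tensor_ind=> [a b|s t es et]; rewrite ?tmul_tens ?mulr1 ?tmulDl ?es ?et.
Qed.

HB.instance Definition _ := GRing.Zmodule_isPzRing.Build (tensor A B)
  tmulA tmul1 tmulr1 tmulDl tmulDr.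

Lemma tensM a b a' b' : tens a b * tens a' b' = tens (a * a') (b * b') :> tensor A B.
Proof. exact: tmul_tens. Qed.

End TensorAlgebra.

HB.mixin Record Algebra_isBialgebra (k : fieldType) A of GRing.Algebra k A := {
  comul : A -> tensor A A;
  counit : A -> k;
  comul_linear : linear comul;
  comul_monoid_morphism : monoid_morphism comul;
  counit_linear : scalar counit;
  counit_monoid_morphism : monoid_morphism counit;
  comulA : forall a : A, tassoc (tmap comul id (comul a)) = tmap id comul (comul a);
  counitl : forall a : A, tlift (fun x y => counit x *: y) (comul a) = a;
  counitr : forall a : A, tlift (fun x y => counit y *: x) (comul a) = a }.

#[short(type="bialgType")]
HB.structure Definition Bialgebra (k : fieldType) :=
  { A of GRing.Algebra k A & Algebra_isBialgebra k A }.

Definition bialgebra_isomorphic (k : fieldType) (A B : bialgType k) : Prop :=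
  exists f : A -> B,
    [/\ linear f, monoid_morphism f, bijective f,
        forall a, comul (f a) = tmap f f (comul a)
      & forall a, counit (f a) = counit a].

Lemma id_linear (k : fieldType) (V : lmodType k) : linear (@id V).
Proof. by []. Qed.

Lemma comp_linear (k : fieldType) (U V W : lmodType k) (f : V -> W) (g : U -> V) :
  linear f -> linear g -> linear (f \o g).
Proof. by move=> lf lg a x y; rewrite /= lg lf. Qed.

Section TensorFunctor.
Variables (k : fieldType).

Lemma tmap_comp (V V' V'' W W' W'' : lmodType k) (f : V' -> V'') (f' : V -> V')
    (g : W' -> W'') (g' : W -> W') :
    linear f -> linear f' -> linear g -> linear g' ->
  forall t, tmap f g (tmap f' g' t) = tmap (f \o f') (g \o g') t.
Proof.
move=> lf lf' lg lg'; apply: tensor_linear_eq => [||v w].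
- by apply: comp_linear; exact: tmap_linear.
- by apply: tmap_linear; exact: comp_linear.
- by rewrite !tmap_tens //; exact: comp_linear.
Qed.

Lemma tassoc_nat (U U' V V' W W' : lmodType k) (f : U -> U') (g : V -> V')
    (h : W -> W') : linear f -> linear g -> linear h ->
  forall t, tassoc (tmap (tmap f g) h t) = tmap f (tmap g h) (tassoc t).
Proof.
move=> lf lg lh; have lfg := tmap_linear lf lg; have lgh := tmap_linear lg lh.
have t1 := tmap_linear lfg lh; have t2 := tmap_linear lf lgh.
have tl1 := @tassoc_linear k U V W; have tl2 := @tassoc_linear k U' V' W'.
apply: tensor_linear_eq => [||t w].
- exact: comp_linear.
- exact: (comp_linear t2 tl1).
elim/tensor_ind: t => [u v|s t es et].
  by rewrite tmap_tens // tmap_tens // !tassoc_tens !tmap_tens.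
rewrite tensDl (linD t1) (linD tl2) (linD tl1) (linD t2).
by congr (_ + _).
Qed.

End TensorFunctor.

Definition is_ideal (k : fieldType) (A : algType k) (I : A -> Prop) : Prop :=
  is_vsubspace I /\ forall a x, I x -> I (a * x) /\ I (x * a).

(* The span is I (x) C + C (x) I, as a subspace of C (x) C. *)
Definition is_coideal (k : fieldType) (C : bialgType k) (I : C -> Prop) : Prop :=
  [/\ is_vsubspace I,
      forall x, I x -> linear_span [set t : tensor C C | exists y c, I y /\
                               (t = tens y c \/ t = tens c y)] (comul x)
    & forall x, I x -> counit x = 0].

Record biideal (k : fieldType) (A : bialgType k) := Biideal {
  biideal_pred :> A -> Prop;
  biideal_ideal : is_ideal biideal_pred;
  biideal_coideal : is_coideal biideal_pred }.

Section QuotientBialgebra.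
Variables (k : fieldType) (A : bialgType k) (I : biideal A).

Definition biideal_space : vsubspace A := VSubspace (biideal_ideal I).1.

Definition quotient_bialgebra := quotient_space biideal_space.

HB.instance Definition _ := GRing.Lmodule.on quotient_bialgebra.

Local Notation Q := quotient_bialgebra.

Definition bproj : A -> Q := @qproj _ _ biideal_space.
Definition brepr : Q -> A := @qrepr _ _ biideal_space.

Lemma bproj_linear : linear bproj. Proof. exact: qproj_linear. Qed.
Lemma bproj_eq x y : bproj x = bproj y <-> I (x - y).
Proof. exact: (qproj_eq biideal_space). Qed.
Lemma breprK : cancel brepr bproj. Proof. exact: qreprK. Qed.
Lemma bprojP q : exists x, q = bproj x. Proof. by exists (brepr q); rewrite breprK. Qed.
Lemma brepr_sub x : I (brepr (bproj x) - x).
Proof. by apply/bproj_eq; rewrite breprK. Qed.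

Lemma biideal_mul x x' y y' : I (x - x') -> I (y - y') -> I (x * y - x' * y').
Proof.
move=> Ix Iy; have -> : x * y - x' * y' = (x - x') * y + x' * (y - y').
  by rewrite mulrBl mulrBr addrA subrK.
have [sI idI] := biideal_ideal I.
by apply: subspaceD => //; [have [] := idI y _ Ix | have [] := idI x' _ Iy].
Qed.

Definition bmul (q r : Q) : Q := bproj (brepr q * brepr r).

Lemma bmulE x y : bmul (bproj x) (bproj y) = bproj (x * y).
Proof. by apply/bproj_eq; apply: biideal_mul; exact: brepr_sub. Qed.

Lemma bmulA : associative bmul.
Proof.
move=> q r s; have [[x ->] [y ->]] := (bprojP q, bprojP r).
by have [z ->] := bprojP s; rewrite !bmulE mulrA.
Qed.
Lemma bmul1 : left_id (bproj 1) bmul.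
Proof. by move=> q; have [x ->] := bprojP q; rewrite bmulE mul1r. Qed.
Lemma bmulr1 : right_id (bproj 1) bmul.
Proof. by move=> q; have [x ->] := bprojP q; rewrite bmulE mulr1. Qed.
Lemma bmulDl : left_distributive bmul +%R.
Proof.
move=> q r s; have [[x ->] [y ->]] := (bprojP q, bprojP r).
have [z ->] := bprojP s.
by rewrite -(linD bproj_linear x y) !bmulE mulrDl (linD bproj_linear).
Qed.
Lemma bmulDr : right_distributive bmul +%R.
Proof.
move=> s q r; have [[x ->] [y ->]] := (bprojP q, bprojP r).
have [z ->] := bprojP s.
by rewrite -(linD bproj_linear x y) !bmulE mulrDr (linD bproj_linear).
Qed.
Lemma bproj1_neq0 : bproj 1 != 0.
Proof.
apply/eqP; rewrite -(lin0 bproj_linear) => /bproj_eq; rewrite subr0 => I1.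
have [_ _ /(_ _ I1)/eqP] := biideal_coideal I.
by rewrite (counit_monoid_morphism (s := A)).1 oner_eq0.
Qed.

HB.instance Definition _ := GRing.Zmodule_isNzRing.Build Q
  bmulA bmul1 bmulr1 bmulDl bmulDr bproj1_neq0.

Lemma bprojM x y : bproj (x * y) = bproj x * bproj y.
Proof. by rewrite -bmulE. Qed.

Lemma bscaleAl (a : k) (q r : Q) : a *: (q * r) = (a *: q) * r.
Proof.
have [[x ->] [y ->]] := (bprojP q, bprojP r).
by rewrite -bprojM -!(linZ bproj_linear) -bprojM scalerAl.
Qed.
HB.instance Definition _ := GRing.Lmodule_isLalgebra.Build k Q bscaleAl.

Lemma bscaleAr (a : k) (q r : Q) : a *: (q * r) = q * (a *: r).
Proof.
have [[x ->] [y ->]] := (bprojP q, bprojP r).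
by rewrite -bprojM -!(linZ bproj_linear) -bprojM scalerAr.
Qed.
HB.instance Definition _ := GRing.Lalgebra_isAlgebra.Build k Q bscaleAr.

(* Comultiplication and counit of a representative; bcomulE and bcounitE show
   that they do not depend on it. *)
Definition bcomul (q : Q) : tensor Q Q := tmap bproj bproj (comul (brepr q)).
Definition bcounit (q : Q) : k := counit (brepr q).

Let tl := tmap_linear bproj_linear bproj_linear.

Lemma bcomulE x : bcomul (bproj x) = tmap bproj bproj (comul x).
Proof.
apply/eqP; rewrite -subr_eq0 -(linB tl) -(linB (comul_linear (s := A))).
apply/eqP; have [_ coI _] := biideal_coideal I.
move: (coI _ (brepr_sub x)); move: (comul _).
apply: (span_sub (kernel_subspace tl)) => t [y [c [Iy tE]]] /=.
have y0 : bproj y = 0 by apply: qproj0.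
by case: tE => ->; rewrite tmap_tens ?y0 ?tens0l ?tens0r //; exact: bproj_linear.
Qed.

Lemma bcounitE x : bcounit (bproj x) = counit x.
Proof.
apply/eqP; rewrite -subr_eq0 /bcounit.
rewrite -(linB (V := k^o) (counit_linear (s := A))).
by have [_ _ ->] := biideal_coideal I; last exact: brepr_sub.
Qed.

Lemma tmap_bprojM (s t : tensor A A) :
  tmap bproj bproj (s * t) = tmap bproj bproj s * tmap bproj bproj t.
Proof.
have E := tmap_tens bproj_linear bproj_linear.
elim/tensor_ind: s => [a b|s s' es es']; last first.
  by rewrite mulrDl !(linD tl) es es' mulrDl.
elim/tensor_ind: t => [a' b'|t t' et et']; last first.
  by rewrite mulrDr !(linD tl) et et' mulrDr.
by rewrite tensM !E tensM !bprojM.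
Qed.

Lemma bcomul_linear : linear bcomul.
Proof.
move=> a q r; have [[x ->] [y ->]] := (bprojP q, bprojP r).
by rewrite -bproj_linear !bcomulE (comul_linear (s := A)) tl.
Qed.
Lemma bcomul_monoid_morphism : monoid_morphism bcomul.
Proof.
split=> [|q r].
  rewrite -[1]/(bproj 1) bcomulE (comul_monoid_morphism (s := A)).1.
  by rewrite (tmap_tens bproj_linear bproj_linear).
have [[x ->] [y ->]] := (bprojP q, bprojP r).
by rewrite -bprojM !bcomulE (comul_monoid_morphism (s := A)).2 tmap_bprojM.
Qed.
Lemma bcounit_linear : scalar bcounit.
Proof.
move=> a q r; have [[x ->] [y ->]] := (bprojP q, bprojP r).
by rewrite -bproj_linear !bcounitE (counit_linear (s := A)).
Qed.
Lemma bcounit_monoid_morphism : monoid_morphism bcounit.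
Proof.
split=> [|q r].
  by rewrite -[1]/(bproj 1) bcounitE (counit_monoid_morphism (s := A)).1.
have [[x ->] [y ->]] := (bprojP q, bprojP r).
by rewrite -bprojM !bcounitE (counit_monoid_morphism (s := A)).2.
Qed.

Lemma bcomulA (q : Q) :
  tassoc (tmap bcomul id (bcomul q)) = tmap id bcomul (bcomul q).
Proof.
have [x ->] := bprojP q; rewrite !bcomulE.
have bl := bproj_linear; have il := @id_linear k.
have cl := comul_linear (s := A).
have Ebl : bcomul \o bproj = tmap bproj bproj \o comul.
  by apply/funext => y /=; rewrite bcomulE.
have bcl := bcomul_linear.
rewrite (tmap_comp bcl bl (il Q) bl) (tmap_comp (il Q) bl bcl bl) Ebl.
rewrite -[id \o bproj]/(bproj \o id).
rewrite -(tmap_comp tl cl bl (il A)) -(tmap_comp bl (il A) tl cl).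
by rewrite (tassoc_nat bl bl bl) comulA.
Qed.

Lemma tlift_bproj (f : A -> k) (g : Q -> k) (t : tensor A A) :
    scalar f -> scalar g -> g \o bproj = f ->
  tlift (fun q r => g q *: r) (tmap bproj bproj t)
    = bproj (tlift (fun x y => f x *: y) t)
  /\ tlift (fun q r => g r *: q) (tmap bproj bproj t)
    = bproj (tlift (fun x y => f y *: x) t).
Proof.
move=> lf lg gf.
have bl1 : bilinear_map (fun (q r : Q) => g q *: r).
  split=> [w|v] a x y /=; last by rewrite scalerDr !scalerA mulrC.
  by rewrite lg scalerDl scalerA.
have bl2 : bilinear_map (fun (q r : Q) => g r *: q).
  split=> [w|v] a x y /=; first by rewrite scalerDr !scalerA mulrC.
  by rewrite lg scalerDl scalerA.
have bl3 : bilinear_map (fun (x y : A) => f x *: y).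
  split=> [w|v] a x y /=; last by rewrite scalerDr !scalerA mulrC.
  by rewrite lf scalerDl scalerA.
have bl4 : bilinear_map (fun (x y : A) => f y *: x).
  split=> [w|v] a x y /=; first by rewrite scalerDr !scalerA mulrC.
  by rewrite lf scalerDl scalerA.
have bl := bproj_linear.
elim/tensor_ind: t => [x y|s t [es1 es2] [et1 et2]].
  by rewrite (tmap_tens bl bl) !tlift_tens // !(linZ bl) -gf.
rewrite !(linD tl) !(linD (tlift_linear _)) // !(linD bl).
by rewrite es1 es2 et1 et2.
Qed.

Let bcounit_proj : bcounit \o bproj = counit.
Proof. by apply/funext => x /=; rewrite bcounitE. Qed.

Lemma bcounitl q : tlift (fun x y => bcounit x *: y) (bcomul q) = q.
Proof.
have [x ->] := bprojP q; rewrite bcomulE.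
have [-> _] := tlift_bproj (comul x) (counit_linear (s := A)) bcounit_linear
  bcounit_proj.
by rewrite counitl.
Qed.

Lemma bcounitr q : tlift (fun x y => bcounit y *: x) (bcomul q) = q.
Proof.
have [x ->] := bprojP q; rewrite bcomulE.
have [_ ->] := tlift_bproj (comul x) (counit_linear (s := A)) bcounit_linear
  bcounit_proj.
by rewrite counitr.
Qed.

HB.instance Definition _ := Algebra_isBialgebra.Build k Q
  bcomul_linear bcomul_monoid_morphism bcounit_linear bcounit_monoid_morphism
  bcomulA bcounitl bcounitr.

End QuotientBialgebra.

Section MonoidAlgebra.
Variables (k : fieldType) (S : monoidType).

Definition monoid_algebra : Type := {malg k[S]}.

HB.instance Definition _ := GRing.Lmodule.on monoid_algebra.

Local Notation kS := monoid_algebra.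
Implicit Types (x y z : kS) (s t : S).

Definition msingle s : kS := << s >>.

Lemma monoid_algebra_eq (U : lmodType k) (f g : kS -> U) :
  linear f -> linear g -> (forall s, f (msingle s) = g (msingle s)) -> f =1 g.
Proof. exact: malg_linear_eq. Qed.

Definition msingle_ext (U : lmodType k) (f : S -> U) : kS -> U := malg_ext f.

Lemma msingle_ext_linear (U : lmodType k) (f : S -> U) : linear (msingle_ext f).
Proof. exact: malg_ext_linear. Qed.

Lemma msingle_extE (U : lmodType k) (f : S -> U) s : msingle_ext f (msingle s) = f s.
Proof. exact: malg_extU. Qed.

Definition malg_mul x y : kS := msingle_ext (fun s => msingle_ext (fun t => msingle (s * t)%g) y) x.

Lemma malg_mul_linearl y : linear (malg_mul^~ y). Proof. exact: msingle_ext_linear. Qed.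

Lemma malg_mul_linearr x : linear (malg_mul x).
Proof.
move=> a y z; move: x; apply: monoid_algebra_eq => [||s].
- exact: malg_mul_linearl.
- move=> b u v; have L w : malg_mul (b *: u + v) w = b *: malg_mul u w + malg_mul v w.
    exact: malg_mul_linearl.
  by rewrite !L !scalerDr !scalerA [a * b]mulrC addrACA.
by rewrite /malg_mul !msingle_extE msingle_ext_linear.
Qed.

Lemma malg_mulE s t : malg_mul (msingle s) (msingle t) = msingle (s * t)%g.
Proof. by rewrite /malg_mul !msingle_extE. Qed.

Lemma malg_mulDl : left_distributive malg_mul +%R.
Proof. by move=> x y z; exact: (linD (malg_mul_linearl z)). Qed.

Lemma malg_mulDr : right_distributive malg_mul +%R.
Proof. by move=> z x y; exact: (linD (malg_mul_linearr z)). Qed.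

Lemma monoid_algebra_ind (P : kS -> Prop) :
  P 0 -> (forall a s x, P x -> P (a *: msingle s + x)) -> forall x, P x.
Proof.
move=> P0 PD x; rewrite [x]malg_span; elim/big_rec: _ => // s y _ Py.
exact: PD.
Qed.

Lemma malg_mulA : associative malg_mul.
Proof.
move=> x y z; move: x; apply: monoid_algebra_eq => [||s].
- exact: malg_mul_linearl.
- by apply: (comp_linear (malg_mul_linearl z)); exact: malg_mul_linearl.
move: y; apply: monoid_algebra_eq => [||t].
- by apply: (comp_linear (malg_mul_linearr _)); exact: malg_mul_linearl.
- by apply: (comp_linear (malg_mul_linearl z)); exact: malg_mul_linearr.
move: z; apply: monoid_algebra_eq => [||u].
- by apply: (comp_linear (malg_mul_linearr _)); exact: malg_mul_linearr.
- exact: malg_mul_linearr.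
by rewrite !malg_mulE mulgA.
Qed.

Lemma malg_mul1 : left_id (msingle 1%g) malg_mul.
Proof.
apply: monoid_algebra_eq => // [|s]; first exact: malg_mul_linearr.
by rewrite malg_mulE mul1g.
Qed.

Lemma malg_mulr1 : right_id (msingle 1%g) malg_mul.
Proof.
apply: monoid_algebra_eq => // [|s]; first exact: malg_mul_linearl.
by rewrite malg_mulE mulg1.
Qed.

Lemma msingle_neq0 s : msingle s != 0.
Proof.
apply/eqP => /malgP/(_ s)/eqP; rewrite mcoeffUU mcoeff0 => /eqP.
exact/eqP/oner_neq0.
Qed.

HB.instance Definition _ := GRing.Zmodule_isNzRing.Build kS
  malg_mulA malg_mul1 malg_mulr1 malg_mulDl malg_mulDr (msingle_neq0 1%g).

Lemma msingleM s t : msingle s * msingle t = msingle (s * t)%g.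
Proof. exact: malg_mulE. Qed.

Lemma mscaleAl (a : k) x y : a *: (x * y) = (a *: x) * y.
Proof. by rewrite -[LHS](linZ (malg_mul_linearl y)). Qed.
HB.instance Definition _ := GRing.Lmodule_isLalgebra.Build k kS mscaleAl.

Lemma mscaleAr (a : k) x y : a *: (x * y) = x * (a *: y).
Proof. by rewrite -[LHS](linZ (malg_mul_linearr x)). Qed.
HB.instance Definition _ := GRing.Lalgebra_isAlgebra.Build k kS mscaleAr.

Definition mcomul : kS -> tensor kS kS :=
  msingle_ext (fun s => tens (msingle s) (msingle s)).
Definition mcounit : kS -> k := msingle_ext (fun=> 1 : k^o).

Lemma mcomul_linear : linear mcomul. Proof. exact: msingle_ext_linear. Qed.
Lemma mcounit_linear : scalar mcounit.
Proof. exact: (msingle_ext_linear (fun=> 1 : k^o)). Qed.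
Lemma mcomulE s : mcomul (msingle s) = tens (msingle s) (msingle s).
Proof. exact: msingle_extE. Qed.
Lemma mcounitE s : mcounit (msingle s) = 1.
Proof. exact: (msingle_extE (fun=> 1 : k^o)). Qed.

Lemma mcomul_monoid_morphism : monoid_morphism mcomul.
Proof.
split=> [|x y]; first exact: mcomulE.
have [[l ml] mr] := (mcomul_linear, malg_mul_linearl, malg_mul_linearr).
have tl := @tmul_linearl k kS kS; have tr := @tmul_linearr k kS kS.
move: x; apply: monoid_algebra_eq => [||s].
- exact: (comp_linear l (ml y)).
- exact: (comp_linear (tl _) l).
move: y; apply: monoid_algebra_eq => [||t].
- exact: (comp_linear l (mr _)).
- exact: (comp_linear (tr _) l).
by rewrite msingleM !mcomulE tensM !msingleM.
Qed.

Lemma mcounit_monoid_morphism : monoid_morphism mcounit.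
Proof.
split=> [|x y]; first exact: mcounitE.
have [[l ml] mr] := (mcounit_linear, malg_mul_linearl, malg_mul_linearr).
move: x; apply: (@monoid_algebra_eq k^o) => [||s].
- exact: (comp_linear (W := k^o) l (ml y)).
- by move=> a u v /=; rewrite l mulrDl -mulrA.
move: y; apply: (@monoid_algebra_eq k^o) => [||t].
- exact: (comp_linear (W := k^o) l (mr _)).
- by move=> a u v /=; rewrite l mulrDr mulrCA.
by rewrite msingleM !mcounitE mulr1.
Qed.

Lemma mcomulA x : tassoc (tmap mcomul id (mcomul x)) = tmap id mcomul (mcomul x).
Proof.
have l := mcomul_linear; have il := @id_linear k kS.
move: x; apply: monoid_algebra_eq => [||s].
- exact: (comp_linear (@tassoc_linear _ _ _ _) (comp_linear (tmap_linear l il) l)).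
- exact: (comp_linear (tmap_linear il l) l).
by rewrite mcomulE !tmap_tens // mcomulE tassoc_tens.
Qed.

Lemma mcounitl x : tlift (fun x y => mcounit x *: y) (mcomul x) = x.
Proof.
have bl : bilinear_map (fun (x y : kS) => mcounit x *: y).
  split=> [w|v] a u v' /=; last by rewrite scalerDr !scalerA mulrC.
  by rewrite mcounit_linear scalerDl scalerA.
move: x; apply: monoid_algebra_eq => // [|s].
  exact: (comp_linear (tlift_linear bl) mcomul_linear).
by rewrite mcomulE tlift_tens // mcounitE scale1r.
Qed.

Lemma mcounitr x : tlift (fun x y => mcounit y *: x) (mcomul x) = x.
Proof.
have bl : bilinear_map (fun (x y : kS) => mcounit y *: x).
  split=> [w|v] a u v' /=; first by rewrite scalerDr !scalerA mulrC.
  by rewrite mcounit_linear scalerDl scalerA.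
move: x; apply: monoid_algebra_eq => // [|s].
  exact: (comp_linear (tlift_linear bl) mcomul_linear).
by rewrite mcomulE tlift_tens // mcounitE scale1r.
Qed.

HB.instance Definition _ := Algebra_isBialgebra.Build k kS
  mcomul_linear mcomul_monoid_morphism mcounit_linear mcounit_monoid_morphism
  mcomulA mcounitl mcounitr.

End MonoidAlgebra.

HB.mixin Record isTopologicalMonoid T of Monoid T & Topological T := {
  mulg_continuous : continuous (fun p : T * T => (p.1 * p.2)%g) }.

#[short(type="topologicalMonoidType")]
HB.structure Definition TopologicalMonoid :=
  { T of isTopologicalMonoid T & Monoid T & Topological T }.

Section Span.
Variables (k : fieldType) (V : lmodType k).
Implicit Types (s t : seq V) (v x : V) (W : set V).

Lemma span_nil x : linear_span [set` [::]] x -> x = 0.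
Proof.
apply: (span_sub (W := [set 0])) => //; split => // a u v -> ->.
by rewrite scaler0 addr0.
Qed.

Lemma mem_span s v : v \in s -> linear_span [set` s] v.
Proof. by move=> vs; apply: sub_span. Qed.

Lemma span_cons v s x : linear_span [set` v :: s] x <->
  exists c y, linear_span [set` s] y /\ x = c *: v + y.
Proof.
have sS := span_subspace [set` s]; split.
  move: x; apply: span_sub => [|x /=].
    split; first by exists 0, 0; rewrite scale0r add0r; case: sS.
    move=> a _ _ [c [y [sy ->]]] [d [z [sz ->]]].
    exists (a * c + d), (a *: y + z); split; first by case: sS => _; apply.
    by rewrite scalerDr scalerA scalerDl addrACA.
  rewrite inE => /predU1P[->|xs]; last first.
    by exists 0, x; rewrite scale0r add0r; split => //; exact: mem_span.
  by exists 1, 0; rewrite scale1r addr0; case: sS.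
move=> [c [y [sy ->]]]; have [_] := span_subspace [set` v :: s]; apply.
  by apply: mem_span; rewrite mem_head.
by apply: span_mono sy => z /= zs; rewrite inE zs orbT.
Qed.

Lemma finite_dimensional_sub W s : is_vsubspace W -> W `<=` linear_span [set` s] ->
  finite_dimensional W.
Proof.
elim: s W => [|v s IH] W sW Ws.
  exists [::]; apply/seteqP; split=> // x /span_nil ->; by case: sW.
have sS := span_subspace [set` s].
have sI : is_vsubspace (W `&` linear_span [set` s]).
  split; first by split; [case: sW | case: sS].
  by move=> a x y [Wx sx] [Wy sy]; split; [case: sW | case: sS] => _; apply.
have [t tE] := IH _ sI (@subIsetr _ _ _).
have [WS|/existsNP[w /not_implyP[Ww nw]]] := pselect (W `<=` linear_span [set` s]).
  by exists t; rewrite -tE; apply/seteqP; split=> [x Wx|x []//]; split => //; exact: WS.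
have /span_cons[c [y [sy wE]]] := Ws _ Ww.
have c0 : c != 0.
  by apply/eqP => c0; apply: nw; rewrite wE c0 scale0r add0r.
exists (w :: t); apply/seteqP; split=> x.
  move=> Wx; have /span_cons[d [z [sz xE]]] := Ws _ Wx.
  apply/span_cons; exists (d / c), (x - (d / c) *: w).
  rewrite [_ *: w + _]addrC subrK -tE; split=> //; split.
    by apply: subspaceB => //; exact: subspaceZ.
  rewrite xE {1}wE scalerDr scalerA divfK // opprD addrACA subrr add0r.
  by apply: (subspaceB sS) => //; exact: (subspaceZ _ sS).
move=> /span_cons[d [z []]]; rewrite -tE => -[Wz _] ->.
by case: sW => _; apply.
Qed.

Lemma finite_dimensional_spanP (A : set V) :
  finite_dimensional (linear_span A) <-> exists s, A `<=` linear_span [set` s].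
Proof.
split=> [[s sE]|[s sA]]; first by exists s; rewrite -sE; exact: sub_span.
apply: (finite_dimensional_sub (s := s)); first exact: span_subspace.
by apply: span_sub => //; exact: span_subspace.
Qed.

End Span.

Section FunctionTensor.
Variables (k : fieldType) (V W : lmodType k) (X Y : Type).
Variables (f : V -> X -> k^o) (g : W -> Y -> k^o).

Definition tfun : tensor V W -> (X * Y)%type -> k^o :=
  tlift (fun v w => (fun p => f v p.1 * g w p.2) : (X * Y)%type -> k^o).

Hypotheses (linf : linear f) (ling : linear g).
Hypotheses (injf : forall v, f v = 0 -> v = 0) (injg : forall w, g w = 0 -> w = 0).

Lemma tfun_bilinear :
  bilinear_map (fun v w => (fun p => f v p.1 * g w p.2) : (X * Y)%type -> k^o).
Proof.
split=> [w|v] a x y; apply/funext => p /=.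
  by rewrite linf [LHS]mulrDl; congr (_ + _); rewrite -[LHS]mulrA.
by rewrite ling [LHS]mulrDr; congr (_ + _); exact: mulrCA.
Qed.

Lemma tfun_linear : linear tfun. Proof. exact: (tlift_linear tfun_bilinear). Qed.

Lemma tfun_tens v w p : tfun (tens v w) p = f v p.1 * g w p.2.
Proof. by rewrite /tfun (tlift_tens tfun_bilinear). Qed.

Lemma tens_absorb (s : seq (V * W)) v w : linear_span [set` map fst s] v ->
  exists s', size s' = size s /\
    tens v w + \sum_(p <- s) tens p.1 p.2 = \sum_(p <- s') tens p.1 p.2.
Proof.
elim: s v => [|p s IH] v /=.
  by move/span_nil ->; exists [::]; rewrite big_nil tens0l addr0.
move/span_cons=> [c [y [/IH [s' [ss' E]] ->]]].
exists ((p.1, c *: w + p.2) :: s') => /=; split; first by rewrite ss'.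
rewrite !big_cons -E /= tensDl tensDr tensZl tensZr.
by rewrite addrACA.
Qed.

Lemma tfun_inj t : tfun t = 0 -> t = 0.
Proof.
have [s ->] := tensor_sum t; have [n] := ubnP (size s).
elim: n s => // n IH [|[v w] s] /= ssn s0; first by rewrite big_nil.
have [vs|nvs] := pselect (linear_span [set` map fst s] v).
  have [s' [ss' E]] := tens_absorb w vs.
  move: s0; rewrite big_cons /= E => s0; apply: IH => //.
  by rewrite ss'.
suff w0 : w = 0.
  by move: s0; rewrite big_cons w0 tens0r add0r; apply: IH.
apply: injg; apply/funext => y; apply: contrapT => gwy.
apply: nvs; have {}gwy : g w y != 0 by apply/eqP.
have lc : g w y *: v + \sum_(p <- s) g p.2 y *: p.1 = 0.
  apply: injf; apply/funext => x; rewrite (linD linf) (lin_sum linf).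
  move: s0 => /(congr1 (fun h => h (x, y))).
  rewrite big_cons (linD tfun_linear) (lin_sum tfun_linear) /=.
  rewrite !fctE !fct_sumE tfun_tens /= => e; apply: etrans e; congr (_ + _).
    by rewrite (linZ linf) mulrC.
  apply: eq_bigr => p _; by rewrite tfun_tens (linZ linf) mulrC.
have -> : v = - (g w y)^-1 *: \sum_(p <- s) g p.2 y *: p.1.
  move/eqP: lc; rewrite addr_eq0 => /eqP.
  move=> /(congr1 (fun z => (g w y)^-1 *: z)).
  by rewrite scalerA mulVf // scale1r scalerN scaleNr.
have sS := span_subspace [set` map fst s].
apply: (subspaceZ _ sS); apply: (subspace_sum sS) => p ps.
by apply: (subspaceZ _ sS); apply: mem_span; exact: map_f.
Qed.

End FunctionTensor.

Section Interpolation.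
Variables (k : fieldType) (X : choiceType).
Implicit Types (s : seq (X -> k^o)).

Lemma interpolation s : exists ps : seq (X * (X -> k^o)),
  (forall p, p \in ps -> linear_span [set` s] p.2) /\
  (forall h, linear_span [set` s] h -> h = \sum_(p <- ps) h p.1 *: p.2).
Proof.
elim: s => [|f s [ps [sps E]]].
  by exists [::]; split=> // h /span_nil ->; rewrite big_nil.
have sS := span_subspace [set` s]; have sfS := span_subspace [set` f :: s].
pose P (h : X -> k^o) : X -> k^o := \sum_(p <- ps) h p.1 *: p.2.
have sP h : linear_span [set` s] (P h).
  by apply: (subspace_sum sS) => p /sps sp; exact: (subspaceZ _ sS).
have lP : linear P.
  move=> a u v; rewrite /P scaler_sumr -big_split /=; apply: eq_bigr => p _.
  by rewrite scalerA -scalerDl.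
have [fP|/eqP fP] := pselect (f = P f).
  have sub : linear_span [set` f :: s] `<=` linear_span [set` s].
    move=> h /span_cons[c [y [sy ->]]]; rewrite fP.
    by case: sS => _; apply.
  exists ps; split=> [p /sps sp|h /sub /E //].
  by apply: span_mono sp => z /= zs; rewrite inE zs orbT.
have [y0 r0] : exists y, f y - P f y != 0.
  apply: contrapT => /forallNP H; case/eqP: fP; apply/funext => y.
  by apply/eqP; rewrite -subr_eq0; move/negP/negPn: (H y).
pose r : X -> k^o := (f y0 - P f y0)^-1 *: (f - P f).
have sr : linear_span [set` f :: s] r.
  apply: (subspaceZ _ sfS); apply: (subspaceB sfS).
    by apply: mem_span; rewrite mem_head.
  by apply: span_mono (sP f) => z /= zs; rewrite inE zs orbT.
exists ((y0, r) :: [seq (p.1, p.2 - p.2 y0 *: r) | p <- ps]); split.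
  move=> p; rewrite inE => /predU1P[->//|/mapP[q /sps sq ->]] /=.
  apply: (subspaceB sfS).
    by apply: span_mono sq => z /= zs; rewrite inE zs orbT.
  exact: (subspaceZ _ sfS).
move=> h sh; rewrite big_cons big_map /=.
have -> : \sum_(p <- ps) h p.1 *: (p.2 - p.2 y0 *: r) = P h - P h y0 *: r.
  rewrite /P [in X in _ = _ - X *: _]fct_sumE scaler_suml -sumrB.
  by apply: eq_bigr => p _; rewrite scalerBr scalerA.
have -> : h y0 *: r + (P h - P h y0 *: r) = P h + (h y0 - P h y0) *: r.
  by rewrite scalerBl addrCA.
have /span_cons[c [y [sy ->]]] := sh.
have Py : P y = y by apply: esym; exact: E.
rewrite lP Py -[X in X *: r]/(((c *: f + y) - (c *: P f + y)) y0).
rewrite opprD addrACA subrr addr0 -scalerBr.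
rewrite -[_ y0]/(c * (f y0 - P f y0)) /r scalerA mulfK //.
by rewrite scalerBr [RHS]addrAC [c *: P f + _]addrC subrK.
Qed.

End Interpolation.

Section Representative.
Variables (k : numFieldType) (T : topologicalMonoidType).
Implicit Types (f g : T -> k^o) (x y z : T).

Definition left_translate z f : T -> k^o := fun y => f (z * y)%g.

Definition representative f : Prop :=
  continuous f /\ finite_dimensional (linear_span [set left_translate z f | z in setT]).

Lemma representativeP f : representative f <-> continuous f /\
  exists s : seq (T -> k^o), forall z, linear_span [set` s] (left_translate z f).
Proof.
split=> -[cf].
  move=> /finite_dimensional_spanP[s sf]; split=> //; exists s.
  by move=> z; apply: sf; exists z.
move=> [s sf]; split=> //; apply/finite_dimensional_spanP; exists s.
by move=> _ [z _ <-].
Qed.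

Lemma left_mulg_continuous z : continuous (fun y : T => (z * y)%g).
Proof.
move=> y; apply: (@continuous2_cvg _ _ _ _ _ _ _ _ (fun a b : T => (a * b)%g)).
- exact: (mulg_continuous (z, y)).
- exact: cvg_cst.
- exact: cvg_id.
Qed.

Lemma right_mulg_continuous z : continuous (fun y : T => (y * z)%g).
Proof.
move=> y; apply: (@continuous2_cvg _ _ _ _ _ _ _ _ (fun a b : T => (a * b)%g)).
- exact: (mulg_continuous (y, z)).
- exact: cvg_id.
- exact: cvg_cst.
Qed.

Lemma representativeD a f g : representative f -> representative g ->
  representative (a *: f + g).
Proof.
move=> /representativeP[cf [s sf]] /representativeP[cg [t tg]].
apply/representativeP; split.
  by move=> x; apply: cvgD; [apply: (@cvgM k); [exact: cvg_cst|exact: cf]|exact: cg].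
exists (s ++ t) => z.
have sS := span_subspace [set` s ++ t].
have -> : left_translate z (a *: f + g) = a *: left_translate z f + left_translate z g.
  by [].
apply: sS.2.
  by apply: span_mono (sf z) => h /=; rewrite mem_cat => ->.
by apply: span_mono (tg z) => h /=; rewrite mem_cat => ->; rewrite orbT.
Qed.

Lemma representative0 : representative (0 : T -> k^o).
Proof.
apply/representativeP; split; first by move=> x; exact: cvg_cst.
by exists [::] => z; case: (span_subspace [set` [::] : seq (T -> k^o)]).
Qed.

Lemma representative_subspace : is_vsubspace representative.
Proof. by split; [exact: representative0 | exact: representativeD]. Qed.

Lemma representative1 : representative (fun=> 1).
Proof.
apply/representativeP; split; first by move=> x; exact: cvg_cst.
by exists [:: (fun=> 1)] => z; apply: mem_span; rewrite mem_head.
Qed.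

Lemma representativeM f g : representative f -> representative g ->
  representative (fun x => f x * g x).
Proof.
move=> /representativeP[cf [s sf]] /representativeP[cg [t tg]].
apply/representativeP; split.
  by move=> x; apply: cvgM; [exact: cf | exact: cg].
pose m (u v : T -> k^o) : T -> k^o := fun x => u x * v x.
have ml v : linear (m^~ v).
  move=> a u u'; apply/funext => x; rewrite /m [LHS]mulrDl; congr (_ + _).
  by rewrite -[LHS]mulrA.
have mr u : linear (m u).
  move=> a v v'; apply/funext => x; rewrite /m [LHS]mulrDr; congr (_ + _).
  exact: mulrCA.
pose r := [seq m u v | u <- s, v <- t]; exists r => z.
have rS := span_subspace [set` r].
change (linear_span [set` r] (m (left_translate z f) (left_translate z g))).
apply: (span_linear (ml _) rS _ (sf z)) => u us.
apply: (span_linear (mr _) rS _ (tg z)) => v vt.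
by apply: mem_span; apply/allpairsP; exists (u, v).
Qed.

Lemma representative_left z f : representative f -> representative (left_translate z f).
Proof.
move=> /representativeP[cf [s sf]]; apply/representativeP; split.
  by move=> x; apply: continuous_comp; [exact: left_mulg_continuous|exact: cf].
exists s => y; rewrite (_ : left_translate _ _ = left_translate (z * y)%g f) //.
by apply/funext => x; rewrite /left_translate mulgA.
Qed.

Lemma representative_right z f : representative f -> representative (fun x => f (x * z)%g).
Proof.
move=> /representativeP[cf [s sf]]; apply/representativeP; split.
  by move=> x; apply: continuous_comp; [exact: right_mulg_continuous|exact: cf].
pose R (h : T -> k^o) : T -> k^o := fun x => h (x * z)%g.
have lR : linear R by [].
exists (map R s) => y; rewrite (_ : left_translate _ _ = R (left_translate y f)).
  apply: (span_linear lR (span_subspace _) _ (sf y)) => u us.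
  by apply: mem_span; exact: map_f.
by apply/funext => x; rewrite /left_translate /R mulgA.
Qed.

Record Rep := MkRep {
  rep_fun :> T -> k^o; rep_funP : `[< representative rep_fun >] }.

HB.instance Definition _ := [isSub for rep_fun].
HB.instance Definition _ := [Choice of Rep by <:].

Implicit Types (F G H : Rep).

Lemma repP F : representative F. Proof. exact/asboolP/rep_funP. Qed.

Definition mkrep f (rf : representative f) : Rep := MkRep (asboolT rf).

Lemma rep_eq F G : (forall x, F x = G x) -> F = G.
Proof. by move=> FG; apply: val_inj; exact/funext. Qed.

Lemma rep_oppP f : representative f -> representative (- f).
Proof.
by move=> rf; rewrite -scaleN1r; exact: subspaceZ representative_subspace rf.
Qed.

Definition rep_zero := mkrep representative0.
Definition rep_one := mkrep representative1.
Definition rep_add F G :=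
  mkrep (subspaceD representative_subspace (repP F) (repP G)).
Definition rep_opp F := mkrep (rep_oppP (repP F)).
Definition rep_scale a F := mkrep (subspaceZ a representative_subspace (repP F)).
Definition rep_mul F G := mkrep (representativeM (repP F) (repP G)).

Lemma rep_addA : associative rep_add.
Proof. by move=> F G H; apply: rep_eq => x; exact: addrA. Qed.
Lemma rep_addC : commutative rep_add.
Proof. by move=> F G; apply: rep_eq => x; exact: addrC. Qed.
Lemma rep_add0 : left_id rep_zero rep_add.
Proof. by move=> F; apply: rep_eq => x; exact: add0r. Qed.
Lemma rep_addN : left_inverse rep_zero rep_opp rep_add.
Proof. by move=> F; apply: rep_eq => x; exact: addNr. Qed.

HB.instance Definition _ := GRing.isZmodule.Build Rep
  rep_addA rep_addC rep_add0 rep_addN.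

Lemma rep_mulA : associative rep_mul.
Proof. by move=> F G H; apply: rep_eq => x; exact: mulrA. Qed.
Lemma rep_mul1 : left_id rep_one rep_mul.
Proof. by move=> F; apply: rep_eq => x; exact: mul1r. Qed.
Lemma rep_mulr1 : right_id rep_one rep_mul.
Proof. by move=> F; apply: rep_eq => x; exact: mulr1. Qed.
Lemma rep_mulDl : left_distributive rep_mul +%R.
Proof. by move=> F G H; apply: rep_eq => x; exact: mulrDl. Qed.
Lemma rep_mulDr : right_distributive rep_mul +%R.
Proof. by move=> F G H; apply: rep_eq => x; exact: mulrDr. Qed.
Lemma rep_one_neq0 : rep_one != 0.
Proof.
apply/eqP => /(congr1 (fun F : Rep => F 1%g))/eqP.
exact/negP/(oner_neq0 k).
Qed.

HB.instance Definition _ := GRing.Zmodule_isNzRing.Build Rep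
  rep_mulA rep_mul1 rep_mulr1 rep_mulDl rep_mulDr rep_one_neq0.

Lemma rep_scaleA a b F : rep_scale a (rep_scale b F) = rep_scale (a * b) F.
Proof. by apply: rep_eq => x; exact: mulrA. Qed.
Lemma rep_scale1 : left_id 1 rep_scale.
Proof. by move=> F; apply: rep_eq => x; exact: mul1r. Qed.
Lemma rep_scaleDr : right_distributive rep_scale +%R.
Proof. by move=> a F G; apply: rep_eq => x; exact: mulrDr. Qed.
Lemma rep_scaleDl F : {morph rep_scale^~ F : a b / a + b}.
Proof. by move=> a b; apply: rep_eq => x; exact: mulrDl. Qed.

HB.instance Definition _ := GRing.Zmodule_isLmodule.Build k Rep
  rep_scaleA rep_scale1 rep_scaleDr rep_scaleDl.

Lemma rep_scaleAl a F G : a *: (F * G) = (a *: F) * G.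
Proof. by apply: rep_eq => x; exact: mulrA. Qed.
HB.instance Definition _ := GRing.Lmodule_isLalgebra.Build k Rep rep_scaleAl.

Lemma rep_scaleAr a F G : a *: (F * G) = F * (a *: G).
Proof. by apply: rep_eq => x; exact: mulrCA. Qed.
HB.instance Definition _ := GRing.Lalgebra_isAlgebra.Build k Rep rep_scaleAr.

Lemma rep_fun_linear : linear (rep_fun : Rep -> T -> k^o). Proof. by []. Qed.

Lemma rep_fun_inj F : (F : T -> k^o) = 0 -> F = 0.
Proof. by move=> F0; apply: val_inj. Qed.

Definition rep_tensor : tensor Rep Rep -> (T * T)%type -> k^o :=
  tfun rep_fun rep_fun.

Lemma rep_tensor_linear : linear rep_tensor.
Proof. exact: (tfun_linear rep_fun_linear rep_fun_linear). Qed.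

Lemma rep_tensor_tens F G p : rep_tensor (tens F G) p = F p.1 * G p.2.
Proof. exact: (tfun_tens rep_fun_linear rep_fun_linear). Qed.

Lemma rep_tensor_inj0 t : rep_tensor t = 0 -> t = 0.
Proof. exact: (tfun_inj rep_fun_linear rep_fun_linear rep_fun_inj rep_fun_inj). Qed.

Lemma rep_tensor_inj t u : (forall p, rep_tensor t p = rep_tensor u p) -> t = u.
Proof.
move=> tu; apply/eqP; rewrite -subr_eq0; apply/eqP/rep_tensor_inj0.
by rewrite (linB rep_tensor_linear) (_ : rep_tensor t = rep_tensor u) ?subrr //; exact/funext.
Qed.

Lemma rep_comul_exists F :
  exists t, forall x y, rep_tensor t (x, y) = F (x * y)%g.
Proof.
have [cF [s sE]] := repP F.
have sF z : linear_span [set` s] (left_translate z F) by rewrite -sE; apply: sub_span; exists z.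
have sR h : linear_span [set` s] h -> representative h.
  rewrite -sE; apply: (span_sub representative_subspace) => _ [z _ <-].
  exact: representative_left (repP F).
have [ps [psR psE]] := interpolation s.
pose mk h : Rep :=
  if pselect (representative h) is left rh then mkrep rh else rep_zero.
have mkE h : representative h -> mk h = h :> (T -> k^o).
  by move=> rh; rewrite /mk; case: pselect.
exists (\sum_(p <- ps) tens (mk (fun x => F (x * p.1)%g)) (mk p.2)) => x y.
rewrite (lin_sum rep_tensor_linear) fct_sumE.
have := congr1 (fun h => h y) (psE _ (sF x)); rewrite fct_sumE.
rewrite {1}/left_translate => ->; rewrite big_seq [RHS]big_seq; apply: eq_bigr => p pps.
rewrite rep_tensor_tens mkE ?mkE //=; first exact: (sR _ (psR _ pps)).
exact: representative_right (repP F).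
Qed.

(* The unique element of Rep (x) Rep satisfying rep_comulE, by rep_tensor_inj. *)
Definition rep_comul F : tensor Rep Rep := projT1 (cid (rep_comul_exists F)).
Definition rep_counit F : k := F 1%g.

Lemma rep_comulE F x y : rep_tensor (rep_comul F) (x, y) = F (x * y)%g.
Proof. by rewrite /rep_comul; case: cid. Qed.

Lemma rep_comul_linear : linear rep_comul.
Proof.
move=> a F G; apply: rep_tensor_inj => -[x y].
rewrite rep_tensor_linear rep_comulE.
by rewrite -[RHS]/(a *: rep_tensor (rep_comul F) (x, y) + rep_tensor (rep_comul G) (x, y)) !rep_comulE.
Qed.

Lemma rep_tensorM t u p : rep_tensor (t * u) p = rep_tensor t p * rep_tensor u p.
Proof.
have l := rep_tensor_linear.
elim/tensor_ind: t => [F G|t t' et et']; last first.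
  by rewrite mulrDl !(linD l) !fctE et et' mulrDl.
elim/tensor_ind: u => [F' G'|u u' eu eu']; last first.
  by rewrite mulrDr !(linD l) !fctE eu eu' mulrDr.
by rewrite tensM !rep_tensor_tens; exact: mulrACA.
Qed.

Lemma rep_comul_monoid_morphism : monoid_morphism rep_comul.
Proof.
split=> [|F G]; apply: rep_tensor_inj => -[x y].
  by rewrite rep_comulE rep_tensor_tens [RHS]mulr1.
by rewrite rep_tensorM !rep_comulE.
Qed.

Lemma rep_counit_linear : scalar rep_counit. Proof. by []. Qed.
Lemma rep_counit_monoid_morphism : monoid_morphism rep_counit. Proof. by []. Qed.

Lemma rep_comulA F :
  tassoc (tmap rep_comul id (rep_comul F)) = tmap id rep_comul (rep_comul F).
Proof.
pose E := @tfun k Rep (tensor Rep Rep) T (T * T)%type rep_fun rep_tensor.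
have lE : linear E by exact: (tfun_linear rep_fun_linear rep_tensor_linear).
have Et G t p : E (tens G t) p = G p.1 * rep_tensor t p.2.
  exact: (tfun_tens rep_fun_linear rep_tensor_linear).
have cl := rep_comul_linear; have il := @id_linear k Rep.
have E1 t x y z : E (tmap id rep_comul t) (x, (y, z)) = rep_tensor t (x, (y * z)%g).
  elim/tensor_ind: t => [G H|t u et eu].
    by rewrite (tmap_tens il cl) Et rep_tensor_tens rep_comulE.
  by rewrite (linD (tmap_linear il cl)) (linD lE) (linD rep_tensor_linear) !fctE et eu.
have E2 u G x y z : E (tassoc (tens u G)) (x, (y, z)) = rep_tensor u (x, y) * G z.
  elim/tensor_ind: u => [F1 F2|u v eu ev].
    by rewrite tassoc_tens Et !rep_tensor_tens mulrA.
  rewrite tensDl (linD (@tassoc_linear _ _ _ _)) (linD lE) (linD rep_tensor_linear).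
  by rewrite !fctE eu ev mulrDl.
have E3 t x y z : E (tassoc (tmap rep_comul id t)) (x, (y, z)) = rep_tensor t ((x * y)%g, z).
  elim/tensor_ind: t => [G H|t u et eu].
    by rewrite (tmap_tens cl il) E2 rep_comulE rep_tensor_tens.
  rewrite (linD (tmap_linear cl il)) (linD (@tassoc_linear _ _ _ _)) (linD lE).
  by rewrite (linD rep_tensor_linear) !fctE et eu.
apply/eqP; rewrite -subr_eq0; apply/eqP.
apply: (tfun_inj rep_fun_linear rep_tensor_linear rep_fun_inj rep_tensor_inj0).
rewrite -/E (linB lE); apply/eqP; rewrite subr_eq0; apply/eqP/funext => -[x [y z]].
by rewrite E1 E3 !rep_comulE mulgA.
Qed.

Lemma rep_counitl F : tlift (fun G H => rep_counit G *: H) (rep_comul F) = F.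
Proof.
have bl : bilinear_map (fun G H => rep_counit G *: H).
  split=> [w|v] a u v'; apply: rep_eq => x.
    by rewrite [LHS]mulrDl; congr (_ + _); rewrite -[LHS]mulrA.
  by rewrite [LHS]mulrDr; congr (_ + _); exact: mulrCA.
have ll := tlift_linear bl.
have H t x : tlift (fun G H => rep_counit G *: H) t x = rep_tensor t (1%g, x).
  elim/tensor_ind: t => [G H|t u et eu].
    by rewrite (tlift_tens bl) rep_tensor_tens.
  by rewrite (linD ll) (linD rep_tensor_linear) !fctE -et -eu.
by apply: rep_eq => x; rewrite H rep_comulE mul1g.
Qed.

Lemma rep_counitr F : tlift (fun G H => rep_counit H *: G) (rep_comul F) = F.
Proof.
have bl : bilinear_map (fun G H => rep_counit H *: G).
  split=> [w|v] a u v'; apply: rep_eq => x; last first.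
    by rewrite [LHS]mulrDl; congr (_ + _); rewrite -[LHS]mulrA.
  by rewrite [LHS]mulrDr; congr (_ + _); exact: mulrCA.
have ll := tlift_linear bl.
have H t x : tlift (fun G H => rep_counit H *: G) t x = rep_tensor t (x, 1%g).
  elim/tensor_ind: t => [G H|t u et eu].
    by rewrite (tlift_tens bl) rep_tensor_tens; exact: mulrC.
  by rewrite (linD ll) (linD rep_tensor_linear) !fctE -et -eu.
by apply: rep_eq => x; rewrite H rep_comulE mulg1.
Qed.

HB.instance Definition _ := Algebra_isBialgebra.Build k Rep
  rep_comul_linear rep_comul_monoid_morphism
  rep_counit_linear rep_counit_monoid_morphism
  rep_comulA rep_counitl rep_counitr.

End Representative.

Section CircleWithZero.
Variable k : numFieldType.

(* For k the complex numbers this is T u {0}, T the unit circle. *)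
Definition circle0_set : set k := [set z | `|z| = 1 \/ z = 0].

Definition circle0 : Type := set_type circle0_set.

HB.instance Definition _ := Topological.copy circle0 (set_type circle0_set).

Definition circle0_val (z : circle0) : k := val z.

Lemma circle0P (z : circle0) : circle0_set (circle0_val z).
Proof. exact: set_valP. Qed.

Lemma circle0_one_subproof : (1 : k) \in circle0_set.
Proof. by apply/mem_set; left; rewrite normr1. Qed.
Definition circle0_one : circle0 := exist _ 1 circle0_one_subproof.

Lemma circle0_mul_subproof (z w : circle0) :
  circle0_val z * circle0_val w \in circle0_set.
Proof.
apply/mem_set; have [nz|->] := circle0P z; last by right; rewrite mul0r.
have [nw|->] := circle0P w; last by right; rewrite mulr0.
by left; rewrite normrM nz nw mulr1.
Qed.
Definition circle0_mul (z w : circle0) : circle0 :=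
  exist _ (circle0_val z * circle0_val w) (circle0_mul_subproof z w).

Lemma circle0_mulA : associative circle0_mul.
Proof. by move=> x y z; apply: val_inj; exact: mulrA. Qed.
Lemma circle0_mulC : commutative circle0_mul.
Proof. by move=> x y; apply: val_inj; exact: mulrC. Qed.
Lemma circle0_mul1 : left_id circle0_one circle0_mul.
Proof. by move=> x; apply: val_inj; exact: mul1r. Qed.
Lemma circle0_mulr1 : right_id circle0_one circle0_mul.
Proof. by move=> x; apply: val_inj; exact: mulr1. Qed.

HB.instance Definition _ := isMonoid.Build circle0
  circle0_mulA circle0_mul1 circle0_mulr1.

Lemma circle0_val_continuous : continuous circle0_val.
Proof. exact: initial_continuous. Qed.

Lemma circle0_mul_continuous :
  continuous (fun p : circle0 * circle0 => (p.1 * p.2)%g).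
Proof.
apply: continuous_comp_initial => p; apply: cvgM.
  by apply: continuous_comp; [exact: cvg_fst | exact: circle0_val_continuous].
by apply: continuous_comp; [exact: cvg_snd | exact: circle0_val_continuous].
Qed.

HB.instance Definition _ := isTopologicalMonoid.Build circle0
  circle0_mul_continuous.

End CircleWithZero.

Section Dual.
Variables (k : numFieldType) (T : topologicalMonoidType).
Local Notation B := (circle0 k).

Definition dual_set : set (T -> B) :=
  [set chi | [/\ continuous chi, chi 1%g = 1%g
              & forall x y, chi (x * y)%g = (chi x * chi y)%g]].

Definition pontryagin_dual : Type := set_type dual_set.

HB.instance Definition _ := Choice.on pontryagin_dual.

Definition dual_fun (chi : pontryagin_dual) : T -> B := val chi.
Coercion dual_fun : pontryagin_dual >-> Funclass.

Implicit Types chi psi : pontryagin_dual.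

Lemma dualP chi : dual_set chi. Proof. exact: set_valP. Qed.

Lemma dual_one_subproof : (fun=> 1%g : B) \in dual_set.
Proof.
apply/mem_set; split=> //; first by move=> x; exact: cvg_cst.
by move=> x y; rewrite mulg1.
Qed.
Definition dual_one : pontryagin_dual := exist (fun f => f \in dual_set) _ dual_one_subproof.

Lemma dual_mul_subproof chi psi : (fun x => (chi x * psi x)%g) \in dual_set.
Proof.
have [[cc c1 cM] [pc p1 pM]] := (dualP chi, dualP psi).
apply/mem_set; split=> [x||x y].
- apply: (@continuous2_cvg _ _ _ _ _ _ _ _ (fun a b : B => (a * b)%g)).
  + exact: (mulg_continuous (chi x, psi x)).
  + exact: cc.
  + exact: pc.
- by rewrite c1 p1 mulg1.
- rewrite cM pM !mulgA; congr (_ * _)%g; rewrite -!mulgA; congr (_ * _)%g.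
  exact: circle0_mulC.
Qed.
Definition dual_mul chi psi : pontryagin_dual := exist (fun f => f \in dual_set) _ (dual_mul_subproof chi psi).

Lemma dual_eq chi psi : (forall x, chi x = psi x) -> chi = psi.
Proof. by move=> E; apply: val_inj; exact/funext. Qed.

Lemma dual_mulA : associative dual_mul.
Proof. by move=> x y z; apply: dual_eq => s; exact: mulgA. Qed.
Lemma dual_mul1 : left_id dual_one dual_mul.
Proof. by move=> x; apply: dual_eq => s; exact: mul1g. Qed.
Lemma dual_mulr1 : right_id dual_one dual_mul.
Proof. by move=> x; apply: dual_eq => s; exact: mulg1. Qed.

HB.instance Definition _ := isMonoid.Build pontryagin_dual dual_mulA dual_mul1 dual_mulr1.

End Dual.

Section DiscreteMonoid.
Variable S : monoidType.

HB.instance Definition _ := isMonoid.Build (discrete_topology S)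
  (@mulgA S) (@mul1g S) (@mulg1 S).

Lemma discrete_mul_continuous : continuous
  (fun p : discrete_topology S * discrete_topology S => (p.1 * p.2)%g).
Proof.
move=> [x y] U /= /principal_filterP Uxy.
exists ([set x], [set y]); first by split; exact/principal_filterP.
by move=> [u v] [/= -> ->].
Qed.

HB.instance Definition _ := isTopologicalMonoid.Build (discrete_topology S)
  discrete_mul_continuous.

End DiscreteMonoid.

Section DiscreteDual.
Variables (k : numFieldType) (S : monoidType).

(* The dual of S with the discrete topology, topologized as a subspace of the
   product of copies of circle0 indexed by S. *)
Definition discrete_dual : Type := pontryagin_dual k (discrete_topology S).

HB.instance Definition _ := Monoid.on discrete_dual.

Definition discrete_dual_fun (chi : discrete_dual) : S -> circle0 k :=
  dual_fun chi.
Coercion discrete_dual_fun : discrete_dual >-> Funclass.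

Definition discrete_dual_embedding (chi : discrete_dual) :
  prod_topology (fun _ : S => circle0 k) := chi.

HB.instance Definition _ := Topological.copy discrete_dual
  (initial_topology discrete_dual_embedding).

Lemma discrete_dual_eval_continuous (s : S) :
  continuous (fun chi : discrete_dual => chi s).
Proof.
move=> chi; apply: (@continuous_comp _ _ _ discrete_dual_embedding (proj s)).
  exact: initial_continuous.
exact: proj_continuous.
Qed.

Lemma discrete_dual_mul_continuous :
  continuous (fun p : discrete_dual * discrete_dual => (p.1 * p.2)%g).
Proof.
apply: continuous_comp_initial => p; apply/cvg_sup => s.
apply: (continuous_comp_initial (w := fun f : S -> circle0 k => f s)
  (f := fun p : discrete_dual * discrete_dual => discrete_dual_embedding (p.1 * p.2)%g)).
suff C : continuous (fun p : discrete_dual * discrete_dual => (p.1 s * p.2 s)%g).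
  exact: C.
have C1 : continuous (fun p : discrete_dual * discrete_dual => p.1 s).
  move=> q; apply: (@continuous_comp _ _ _ fst (fun chi : discrete_dual => chi s)).
    exact: cvg_fst.
  exact: discrete_dual_eval_continuous.
have C2 : continuous (fun p : discrete_dual * discrete_dual => p.2 s).
  move=> q; apply: (@continuous_comp _ _ _ snd (fun chi : discrete_dual => chi s)).
    exact: cvg_snd.
  exact: discrete_dual_eval_continuous.
move=> q; apply: (@continuous2_cvg _ _ _ _ _ _ _ _ (fun a b : circle0 k => (a * b)%g)).
- exact: (mulg_continuous ((q.1 : discrete_dual) s, (q.2 : discrete_dual) s)).
- exact: C1.
- exact: C2.
Qed.

HB.instance Definition _ := isTopologicalMonoid.Build discrete_dual
  discrete_dual_mul_continuous.

End DiscreteDual.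

(* Covers both orientations: the product is the glb for semilattice_le below and
   the lub for the opposite order. *)
HB.mixin Record Monoid_isBoundedSemilattice S of Monoid S := {
  mulg_comm : forall s t : S, (s * t)%g = (t * s)%g;
  mulg_idem : forall s : S, (s * s)%g = s }.

#[short(type="boundedSemilatticeType")]
HB.structure Definition BoundedSemilattice :=
  { S of Monoid S & Monoid_isBoundedSemilattice S }.

Section SemilatticeOrder.
Variable S : boundedSemilatticeType.
Implicit Types s t u : S.

Definition semilattice_le s t := (s * t)%g = s.

Lemma semilattice_le_refl s : semilattice_le s s.
Proof. exact: mulg_idem. Qed.

Lemma semilattice_le_anti s t :
  semilattice_le s t -> semilattice_le t s -> s = t.
Proof. by rewrite /semilattice_le => st ts; rewrite -st mulg_comm. Qed.

Lemma semilattice_le_trans t s u :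
  semilattice_le s t -> semilattice_le t u -> semilattice_le s u.
Proof. by rewrite /semilattice_le => st tu; rewrite -{1}st -mulgA tu. Qed.

Lemma semilattice_glb s t u :
  semilattice_le u (s * t)%g <-> semilattice_le u s /\ semilattice_le u t.
Proof.
rewrite /semilattice_le; split=> [ust|[us ut]]; last by rewrite mulgA us ut.
split; rewrite -[in RHS]ust -{1}ust -!mulgA; congr (_ * _)%g.
  by rewrite [(t * s)%g]mulg_comm mulgA mulg_idem.
by rewrite mulg_idem.
Qed.

Lemma semilattice_le1 s : semilattice_le s 1%g.
Proof. exact: mulg1. Qed.

End SemilatticeOrder.

(* Main.v *)
Require Import Defs.
From mathcomp Require Import all_boot all_order all_algebra.
From mathcomp Require Import finmap monalg.
From mathcomp Require Import all_classical all_reals all_analysis.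
From mathcomp Require Import complex.

(** Write D for the dual of S. Each s in S gives the function chi |-> chi s on D,
    a representative function since left translation by psi multiplies it by
    the scalar psi s. Extending linearly gives a bialgebra morphism
    [evaluation] from kS to Rep(D): evaluations are grouplike in Rep(D) and
    multiply like the elements of S. This morphism is an isomorphism, so the
    zero biideal is a suitable I and both claims follow.

    Injectivity. A bounded semilattice has enough characters with values in
    {0, 1}: the indicator of the principal filter above s is one. If x in kS is
    nonzero and s is a maximal element of its support, evaluating x at this
    character returns the coefficient of x at s ([evaluation_injective]).

    Surjectivity. It has two parts.
    - D is itself a commutative monoid of idempotents, because an element of
      D takes idempotent values, that is 0 or 1. The translates of a
      representative function f span a finite dimensional space, on which the
      translations are commuting projections; splitting f repeatedly into
      L_z f and f - L_z f decreases the dimension, until only functions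
      scaled by 0 or 1 by every translation remain, and these are multiples of
      continuous characters of D ([representative_span_character]).
    - A continuous character l of D is evaluation at some s in S. The
      pointwise infimum chi0 of l^-1(1) is again in l^-1(1) since this
      set is closed and stable under products. Since l is locally constant,
      finitely many conditions chi t = chi0 t force l chi = 1, and the
      product s of those t for which chi0 t = 1 satisfies l chi = chi s
      ([character_is_evaluation]). *)

Set Implicit Arguments.
Unset Strict Implicit.
Unset Printing Implicit Defensive.

Import Order.TTheory GRing.Theory Num.Theory.
Import numFieldNormedType.Exports.

Local Open Scope classical_set_scope.
Local Open Scope ring_scope.

(** * Dimension of proper subspaces *)

Section SpanDimension.
Variables (k : fieldType) (V : lmodType k).
Implicit Types (s : seq V) (w : V) (W : set V).

(** The size of a spanning list serves as a dimension bound. This is the strict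
    decrease that makes the splitting of a representative function stop. *)
Lemma proper_subspace_span W s w : is_vsubspace W ->
    W `<=` linear_span [set` s] -> linear_span [set` s] w -> ~ W w ->
  exists2 t, (size t < size s)%N & W `<=` linear_span [set` t].
Proof.
elim: s W w => [|v s IH] W w sW Ws sw nWw.
  by case: nWw; rewrite (Defs.span_nil sw); case: sW.
have sS := span_subspace [set` s].
have [Wsub|/existsNP[w' /not_implyP[Ww' nsw']]] :=
  pselect (W `<=` linear_span [set` s]).
  by exists s.
have /Defs.span_cons[c [y [sy wE]]] := sw.
have /Defs.span_cons[d [y' [sy' w'E]]] := Ws _ Ww'.
have d0 : d != 0.
  by apply/eqP => d0; apply: nsw'; rewrite w'E d0 scale0r add0r.
have sI : is_vsubspace (W `&` linear_span [set` s]).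
  split; first by split; [case: sW | case: sS].
  by move=> a x z [Wx sx] [Wz sz]; split; [case: sW | case: sS] => _; apply.
(* Subtracting the right multiple of w' eliminates the v-component of w without
   bringing w into W, so the claim for the tail s applies to the part of W in
   the span of s. *)
have [|||t ltts Wt] := IH _ (w - (c / d) *: w') sI.
- by move=> x [].
- rewrite wE w'E scalerDr scalerA divfK // opprD addrACA subrr add0r.
  by apply: (subspaceB sS) => //; exact: (subspaceZ _ sS).
- move=> [Wd _]; apply: nWw; rewrite -(subrK ((c / d) *: w') w).
  by apply: (subspaceD sW) => //; exact: (subspaceZ _ sW).
exists (w' :: t) => // x Wx; have /Defs.span_cons[e [z [sz xE]]] := Ws _ Wx.
apply/Defs.span_cons; exists (e / d), (x - (e / d) *: w').
rewrite [_ *: w' + _]addrC subrK; split=> //; apply: Wt; split.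
  by apply: (subspaceB sW) => //; exact: (subspaceZ _ sW).
rewrite xE w'E scalerDr scalerA divfK // opprD addrACA subrr add0r.
by apply: (subspaceB sS) => //; exact: (subspaceZ _ sS).
Qed.

End SpanDimension.

(** * Representative functions on commutative idempotent monoids *)

Section IdempotentMonoid.
Variables (k : numFieldType) (T : topologicalMonoidType).
Hypothesis mulTC : forall x y : T, (x * y)%g = (y * x)%g.
Hypothesis mulTI : forall x : T, (x * x)%g = x.

Definition characters : set (T -> k^o) :=
  [set l : T -> k^o | [/\ continuous l, l 1%g = 1 & forall x y, l (x * y)%g = l x * l y]].

Local Notation translate := (@left_translate k T).

Lemma translate_linear z : linear (translate z : (T -> k^o) -> T -> k^o).
Proof. by []. Qed.

Lemma translate_idem z f : translate z (translate z f) = translate z f.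
Proof. by apply/funext => y; rewrite /left_translate mulgA mulTI. Qed.

Lemma translate_comp z w f : translate w (translate z f) = translate (z * w)%g f.
Proof. by apply/funext => y; rewrite /left_translate mulgA. Qed.

Lemma translate1 f : translate 1%g f = f.
Proof. by apply/funext => y; rewrite /left_translate mul1g. Qed.

(** Since f z = (L_z f) 1, the function f vanishes if f 1 = 0, and otherwise
    f / f 1 takes the value 1 or 0 at z according to whether L_z f is f or 0. *)
Lemma indecomposable_character (f : T -> k^o) : continuous f ->
    (forall z, translate z f = f \/ translate z f = 0) ->
  linear_span characters f.
Proof.
move=> cf fdec; have sS := span_subspace characters.
have fE z : f z = translate z f 1%g by rewrite /left_translate mulg1.
have [f10|f10] := eqVneq (f 1%g) 0.
  suff -> : f = 0 by case: sS.
  by apply/funext => z; rewrite fE; have [->|->] := fdec z.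
rewrite -[f]scale1r -(divff f10) -scalerA.
apply: (subspaceZ _ sS); apply: (@Defs.sub_span _ _ characters); split.
- by move=> x; apply: (@cvgM k); [exact: cvg_cst | exact: cf].
- exact: mulVf.
- move=> x y; rewrite -[LHS]/((f 1%g)^-1 * translate x f y).
  rewrite -[RHS]/(((f 1%g)^-1 * f x) * ((f 1%g)^-1 * f y)) (fE x).
  by have [->|->] := fdec x; rewrite ?mulVf ?mul1r // ?mulr0 ?mul0r.
Qed.

(** If L_z f is neither f nor 0, then f is the sum of f1 = L_z f and
    f2 = f - L_z f, both nonzero. As L_z is idempotent and commutes with all
    translations, it is the identity on the translates of f1 and zero on
    those of f2. Hence f2 is outside the first span and f1 outside the second,
    and both spans have smaller dimension than that of f. *)
Lemma representative_span_character (f : T -> k^o) :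
  representative f -> linear_span characters f.
Proof.
move=> /representativeP[cf [s sf]]; have [n] := ubnP (size s).
elim: n s f cf sf => // n IH s f cf sf; rewrite ltnS => ltsn.
have sS := span_subspace [set` s].
have [fdec|/existsNP[z /not_orP[fz fz0]]] :=
  pselect (forall z, translate z f = f \/ translate z f = 0).
  exact: indecomposable_character.
pose f1 := translate z f; pose f2 := f - f1.
have sf1 w : linear_span [set` s] (translate w f1).
  by rewrite translate_comp; exact: sf.
have sf2 w : linear_span [set` s] (translate w f2).
  by rewrite (linB (translate_linear w)); apply: (subspaceB sS); [exact: sf | exact: sf1].
have zf1 : translate z f1 = f1 by exact: translate_idem.
have zf2 : translate z f2 = 0 by rewrite (linB (translate_linear z)) zf1 subrr.
have cf1 : continuous f1.
  by move=> x; apply: continuous_comp; [exact: left_mulg_continuous | exact: cf].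
have cf2 : continuous f2 by move=> x; apply: cvgB; [exact: cf | exact: cf1].
have translateC w g : translate z (translate w g) = translate w (translate z g).
  by rewrite !translate_comp mulTC.
(* Some h in the ambient span but outside the span of the translates of g
   witnesses that the latter is generated by fewer vectors. *)
have smaller g h : (forall w, linear_span [set` s] (translate w g)) ->
    linear_span [set` s] h ->
    ~ linear_span [set translate w g | w in setT] h ->
  exists2 t, (size t < n)%N & forall w, linear_span [set` t] (translate w g).
  move=> sg sh ngh; have sW := span_subspace [set translate w g | w in setT].
  have [|t tlt tP] := proper_subspace_span sW _ sh ngh.
    by apply: (span_sub sS) => _ [w _ <-]; exact: sg.
  exists t; first exact: leq_trans tlt _.
  by move=> w; apply: tP; apply: Defs.sub_span; exists w.
have [|||t1 lt1 t1P] := smaller f1 f2 => //.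
- by rewrite -[f2]translate1.
- move=> W1f2; have /= := @span_sub k (T -> k^o) _ [set g | translate z g - g = 0] _ _ _ W1f2.
  rewrite zf2 sub0r => H; apply: fz; apply/eqP; rewrite eq_sym -subr_eq0 -oppr_eq0.
  apply/eqP; apply: H.
    apply: kernel_subspace => a u v.
    by rewrite translate_linear scalerBr opprD addrACA.
  by move=> _ [w _ <-] /=; rewrite translateC zf1 subrr.
have [|||t2 lt2 t2P] := smaller f2 f1 => //.
- by rewrite -[f1]translate1.
- move=> W2f1; have /= := @span_sub k (T -> k^o) _ [set g | translate z g = 0] _ _ _ W2f1.
  rewrite zf1; apply: contra_not fz0 => H; apply: H => //.
  + exact: (kernel_subspace (translate_linear z)).
  + by move=> _ [w _ <-] /=; rewrite translateC zf2.
rewrite -(subrK f1 f); apply: (subspaceD (span_subspace characters)).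
- exact: IH cf2 t2P lt2.
- exact: IH cf1 t1P lt1.
Qed.

End IdempotentMonoid.

(** * The dual of a bounded semilattice *)

Lemma idempotent_eq1_or_eq0 (A : idomainType) (x : A) : x * x = x -> x = 1 \/ x = 0.
Proof.
move/eqP; rewrite -subr_eq0 -{3}[x]mulr1 -mulrBr mulf_eq0 subr_eq0 orbC.
by case/orP => /eqP; [left | right].
Qed.

Section DiscreteDualSemilattice.
Variables (k : numFieldType) (S : boundedSemilatticeType).
Local Notation D := (discrete_dual k S).
Implicit Types (chi psi : D) (s t : S) (ts : seq S).

Lemma discrete_dual_morphism chi : chi 1%g = 1%g /\ forall s t, chi (s * t)%g = (chi s * chi t)%g.
Proof. by have [] := dualP chi. Qed.

Lemma discrete_dual_mulE chi psi s : ((chi * psi)%g : D) s = (chi s * psi s)%g.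
Proof. by []. Qed.

Lemma discrete_dual_val_idem chi s : (chi s * chi s)%g = chi s.
Proof. by rewrite -(discrete_dual_morphism chi).2 mulg_idem. Qed.

Lemma discrete_dual_val_cases chi s : chi s = 1%g \/ circle0_val (chi s) = 0.
Proof.
have /(congr1 (@circle0_val k)) := discrete_dual_val_idem chi s.
case/(@idempotent_eq1_or_eq0 k (circle0_val (chi s))) => h; [left | right] => //.
exact: val_inj.
Qed.

(** As the values are 0 or 1, comparing them amounts to comparing the conditions
    of being 1; this turns equations between values into logic. *)
Lemma discrete_dual_val_eq chi psi s t :
  (chi s = 1%g <-> psi t = 1%g) -> chi s = psi t.
Proof.
have [->|c0] := discrete_dual_val_cases chi s; first by case=> /(_ erefl) ->.
have [->|p0] := discrete_dual_val_cases psi t; first by case=> _ /(_ erefl) ->.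
by move=> _; apply: val_inj; rewrite /= -!/(circle0_val _) c0 p0.
Qed.

Lemma discrete_dual_val_mul_eq1 chi psi s t :
  (chi s * psi t)%g = 1%g <-> chi s = 1%g /\ psi t = 1%g.
Proof.
split=> [h|[-> ->]]; last exact: mulg1.
have /(congr1 (@circle0_val k)) := h.
rewrite -[circle0_val (_ * _)%g]/(circle0_val (chi s) * circle0_val (psi t)).
have [c1|->] := discrete_dual_val_cases chi s; last by rewrite mul0r => /esym/eqP; rewrite oner_eq0.
have [p1|->] := discrete_dual_val_cases psi t; last by rewrite mulr0 => /esym/eqP; rewrite oner_eq0.
by [].
Qed.

Lemma discrete_dual_mulC chi psi : (chi * psi)%g = (psi * chi)%g.
Proof. by apply: dual_eq => s; exact: circle0_mulC. Qed.

Lemma discrete_dual_mul_idem chi : (chi * chi)%g = chi.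
Proof. by apply: dual_eq => s; exact: discrete_dual_val_idem. Qed.

Lemma circle0_zero_subproof : (0 : k) \in @circle0_set k.
Proof. by apply/mem_set; right. Qed.

Definition circle0_zero : circle0 k := exist _ 0 circle0_zero_subproof.

(** The elements of the dual are exactly the indicators of filters of S; this
    section gives the direction from filters to elements of the dual. *)
Section FilterCharacter.
Variable P : S -> Prop.
Hypotheses (P1 : P 1%g) (PM : forall s t, P (s * t)%g <-> P s /\ P t).

Definition filter_indicator (t : discrete_topology S) : circle0 k :=
  if `[< P t >] then 1%g else circle0_zero.

Lemma filter_indicator_dual :
  filter_indicator \in @dual_set k (discrete_topology S).
Proof.
apply/mem_set; split=> [x U|| x y].
- by move=> /nbhs_singleton Ux /=; apply/principal_filterP.
- by rewrite /filter_indicator asboolT.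
- rewrite /filter_indicator; case: (asboolP (P x)) => Px; last first.
    rewrite asboolF; first by apply: val_inj; exact: esym (mul0r _).
    by move/PM => [].
  rewrite mul1g; congr (if _ then _ else _); apply/asbool_equiv_eq.
  by rewrite PM; split=> [[]|].
Qed.

Definition filter_character : D :=
  exist (fun f => f \in @dual_set k (discrete_topology S)) _ filter_indicator_dual.

Lemma filter_characterE t : filter_character t = 1%g <-> P t.
Proof.
rewrite -[filter_character t]/(filter_indicator t) /filter_indicator.
case: asboolP => // nP; split=> // /(congr1 (@circle0_val k)) /esym/eqP.
by rewrite -[X in X == _]/1 oner_eq0.
Qed.

End FilterCharacter.

(** The sets of chi that agree with chi0 at finitely many points form a
    filter; it converges to chi0 because it does so in each coordinate of the
    product, and every neighbourhood of chi0 therefore belongs to it. *)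
Lemma discrete_dual_nbhs chi0 (U : set D) : nbhs chi0 U ->
  exists ts, forall chi, {in ts, chi =1 chi0} -> U chi.
Proof.
pose F : set_system D :=
  [set A | exists ts, forall chi, {in ts, chi =1 chi0} -> A chi].
have FF : Filter F.
  split; first by exists [::].
  - move=> A B [ts At] [us Bu]; exists (ts ++ us) => chi h; split.
      by apply: At => t tt; apply: h; rewrite mem_cat tt.
    by apply: Bu => t tt; apply: h; rewrite mem_cat tt orbT.
  - by move=> A B AB [ts At]; exists ts => chi /At /AB.
pose emb := @discrete_dual_embedding k S.
suff FC : emb @ F --> emb chi0.
  rewrite nbhsE => -[V [[B oB <-] Bchi0] VU].
  have /FC [ts h] : nbhs (emb chi0) B.
    exact: open_nbhs_nbhs.
  by exists ts => chi /h /VU.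
apply/cvg_sup => t A.
rewrite (@nbhsE (initial_topology _)) => -[V [[B oB <-] Bchi0] VA].
by exists [:: t] => chi h; apply: VA; change (B (chi t)); rewrite h ?mem_head.
Qed.

(** * Continuous characters of the dual are evaluations *)

Section Character.
Variable l : D -> k^o.
Hypothesis lP : characters l.

Lemma character_val_cases chi : l chi = 1 \/ l chi = 0.
Proof.
by have [_ _ lM] := lP; apply: idempotent_eq1_or_eq0; rewrite -lM discrete_dual_mul_idem.
Qed.

(** The values 0 and 1 are at distance 1, so l cannot change value inside the
    preimage of a ball of radius 1. *)
Lemma character_locally_constant chi0 :
  exists ts, forall chi, {in ts, chi =1 chi0} -> l chi = l chi0.
Proof.
have [cl _ _] := lP.
have /discrete_dual_nbhs : nbhs chi0 (l @^-1` ball (l chi0) 1).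
  by apply: cl; apply: nbhsx_ballx.
case=> ts h; exists ts => chi /h; rewrite /= -ball_normE /=.
by have [->|->] := character_val_cases chi; have [->|->] := character_val_cases chi0;
  rewrite ?subrr // ?subr0 ?sub0r ?normrN normr1 ltxx.
Qed.

(* P is the intersection of the filters corresponding to the elements of
   l^-1(1), so its character chi0 is the infimum of l^-1(1). *)
Let P t := forall chi, l chi = 1 -> chi t = 1%g.

Let P1 : P 1%g. Proof. by move=> chi _; exact: (discrete_dual_morphism chi).1. Qed.

Let PM s t : P (s * t)%g <-> P s /\ P t.
Proof.
split=> [Pst|[Ps Pt] chi l1]; last by rewrite (discrete_dual_morphism chi).2 Ps // Pt // mulg1.
by split=> chi /Pst; rewrite (discrete_dual_morphism chi).2 => /discrete_dual_val_mul_eq1[].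
Qed.

Let chi0 := filter_character P1 PM.

Let chi0E t : chi0 t = 1%g <-> P t. Proof. exact: filter_characterE. Qed.

(* chi0 is in the closure of l^-1(1): wherever chi0 t = 0, some element of
   l^-1(1) vanishes at t, and a finite product of such elements agrees with
   chi0 at all prescribed points. *)
Let near_chi0 ts : exists2 chi, l chi = 1 & {in ts, chi =1 chi0}.
Proof.
have [_ l1 lM] := lP.
elim: ts => [|t ts [chi lchi h]]; first by exists 1%g.
have [c1|c1] := pselect (chi0 t = 1%g).
  exists chi => // u; rewrite inE => /predU1P[->|/h //].
  by rewrite c1; apply: (chi0E t).1.
have /existsNP[psi /not_implyP[lpsi psit]] : ~ P t by rewrite -chi0E.
exists (chi * psi)%g; first by rewrite lM lchi lpsi mulr1.
move=> u; rewrite inE => /predU1P[->|/h E];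
  apply: (discrete_dual_val_eq (chi := (chi * psi)%g)).
- by rewrite discrete_dual_mulE discrete_dual_val_mul_eq1; split=> // -[].
- rewrite discrete_dual_mulE discrete_dual_val_mul_eq1 E; split=> [[]//|c0u]; split=> //.
  exact: (chi0E u).1.
Qed.

(* The witness is the product of those t in ts with chi0 t = 1, which turns a
   finite set of conditions on chi into one. *)
Let finite_meet ts : exists s, forall chi,
  chi s = 1%g <-> (forall t, t \in ts -> chi0 t = 1%g -> chi t = 1%g).
Proof.
elim: ts => [|t ts [s h]].
  by exists 1%g => chi; split=> // _; exact: (discrete_dual_morphism chi).1.
have [c1|c1] := pselect (chi0 t = 1%g).
  exists (t * s)%g => chi; rewrite (discrete_dual_morphism chi).2 discrete_dual_val_mul_eq1 h.
  split=> [[ct cs] u|H].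
    by rewrite inE => /predU1P[->//|]; exact: cs.
  split; first by apply: H; rewrite ?mem_head.
  by move=> u us; apply: H; rewrite inE us orbT.
exists s => chi; rewrite h; split=> H u us; last by apply: H; rewrite inE us orbT.
by move: us; rewrite inE => /predU1P[->//|]; exact: H.
Qed.

(** If l chi = 1, then chi is above chi0, hence equal to 1 wherever chi0 is.
    Conversely, if chi s = 1, then chi * chi0 agrees with chi0 on ts, so
    1 = l (chi * chi0) = l chi. *)
Lemma character_is_evaluation : exists s, forall chi, l chi = circle0_val (chi s).
Proof.
have [_ l1 lM] := lP.
have [ts tsP] := character_locally_constant chi0.
have lchi0 : l chi0 = 1.
  by have [chi lchi /tsP] := near_chi0 ts; rewrite lchi.
have [s sP] := finite_meet ts; exists s => chi.
suff E : l chi = 1 <-> chi s = 1%g.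
  have [c1|c0] := discrete_dual_val_cases chi s; first by rewrite E.2 // c1.
  have [lc|->] := character_val_cases chi; last by rewrite c0.
  by rewrite lc (E.1 lc).
rewrite sP; split=> [lchi t _ /chi0E|H]; first exact.
have := tsP (chi * chi0)%g; rewrite lM lchi0 mulr1; apply=> t tts.
apply: (discrete_dual_val_eq (chi := (chi * chi0)%g)).
by rewrite discrete_dual_mulE discrete_dual_val_mul_eq1; split=> [[]//|c0t]; split=> //; exact: H.
Qed.

End Character.

(** * The evaluation morphism *)

(** Every left translate is a scalar multiple of the function itself. *)
Lemma eval_representative s :
  representative (fun chi : D => circle0_val (chi s) : k^o).
Proof.
apply/representativeP; split.
  move=> chi; apply: (@continuous_comp _ _ _ (fun chi : D => chi s)).
    exact: discrete_dual_eval_continuous.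
  exact: circle0_val_continuous.
exists [:: (fun chi : D => circle0_val (chi s) : k^o)] => chi.
rewrite (_ : left_translate _ _ =
  circle0_val ((chi : D) s) *: (fun chi : D => circle0_val (chi s) : k^o)) //.
by apply: (subspaceZ _ (span_subspace _)); apply: mem_span; rewrite mem_head.
Qed.

Local Notation A := (Rep k D).
Local Notation kS := (monoid_algebra k S).

Definition eval s : A := mkrep (eval_representative s).

Definition evaluation : kS -> A := msingle_ext eval.

Lemma evaluation_linear : linear evaluation.
Proof. exact: msingle_ext_linear. Qed.

Lemma evaluationE s : evaluation (msingle k s) = eval s.
Proof. exact: msingle_extE. Qed.

Lemma evalM s t : eval (s * t)%g = eval s * eval t.
Proof. by apply: rep_eq => chi /=; rewrite (discrete_dual_morphism chi).2. Qed.

Lemma eval1 : eval 1%g = 1.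
Proof. by apply: rep_eq => chi /=; rewrite (discrete_dual_morphism chi).1. Qed.

Lemma comul_eval s : comul (eval s) = tens (eval s) (eval s).
Proof.
by apply: rep_tensor_inj => -[chi psi]; rewrite rep_comulE rep_tensor_tens.
Qed.

Lemma evaluation_monoid_morphism : monoid_morphism evaluation.
Proof.
split=> [|x y]; first by rewrite -[1]/(msingle k (1%g : S)) evaluationE eval1.
have l := evaluation_linear.
move: x; apply: monoid_algebra_eq => [||s].
- by move=> a u v; rewrite mulrDl -scalerAl l.
- by move=> a u v; rewrite l mulrDl -scalerAl.
move: y; apply: monoid_algebra_eq => [||t].
- by move=> a u v; rewrite mulrDr -scalerAr l.
- by move=> a u v; rewrite l mulrDr -scalerAr.
by rewrite msingleM !evaluationE evalM.
Qed.

Lemma evaluation_comul x :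
  comul (evaluation x) = tmap evaluation evaluation (comul x).
Proof.
have l := evaluation_linear; have tl := tmap_linear l l.
move: x; apply: monoid_algebra_eq => [||s].
- exact: (comp_linear comul_linear l).
- exact: (comp_linear tl comul_linear).
by rewrite evaluationE comul_eval -[comul _]/(mcomul _) mcomulE tmap_tens // evaluationE.
Qed.

Lemma evaluation_counit x : counit (evaluation x) = counit x.
Proof.
have l := evaluation_linear.
move: x; apply: (@monoid_algebra_eq k S k^o) => [||s].
- by move=> a u v; rewrite l counit_linear.
- exact: counit_linear.
by rewrite evaluationE -[RHS]/(mcounit _) mcounitE.
Qed.

Lemma evaluation_val x chi :
  evaluation x chi = \sum_(s <- msupp x) x@_s * circle0_val (chi s).
Proof.
rewrite /evaluation /msingle_ext malg_ext.unlock.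
by rewrite (lin_sum (@rep_fun_linear k D)) fct_sumE.
Qed.

(** The values of a nonzero x at the indicator of the principal filter above s
    only involve the part of the support above s, which is reduced to s when s is
    maximal in the support. *)
Lemma evaluation_injective : injective evaluation.
Proof.
suff inj0 x : evaluation x = 0 -> x = 0.
  move=> x y exy; apply/eqP; rewrite -subr_eq0; apply/eqP/inj0.
  by rewrite (linB evaluation_linear) exy subrr.
move=> x0; have [//|xn0] := eqVneq x 0.
have [s0 s0x] : exists s, s \in msupp x.
  apply: contrapT => /forallNP H; case/eqP: xn0; apply/malgP => s.
  by rewrite mcoeff0 mcoeff_outdom //; apply/negP; exact: H.
pose le s t := (s * t)%g == s.
pose up (s : msupp x) := [set t : msupp x | le (val s) (val t)]%SET.
(* An s with fewest elements of the support above it is maximal there: the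
   elements above some t >= s are also above s, with equality by minimality. *)
pose s := [arg min_(s < [` s0x]%fset) #|up s|].
have s_maximal (t : msupp x) : le (val s) (val t) -> t = s.
  rewrite /s; case: arg_minnP => // {}s _ mins st.
  have sub : up t \subset up s.
    apply/fintype.subsetP => u; rewrite !inE => /eqP tu; move/eqP: st => st.
    by apply/eqP; rewrite -{1}st -mulgA tu.
  have : s \in up t.
    have /eqP -> : up t == up s by rewrite eqEcard sub mins.
    by rewrite inE; apply/eqP; exact: mulg_idem.
  rewrite inE => /eqP ts; apply: val_inj; rewrite -ts mulg_comm; exact/eqP.
have Ps1 : semilattice_le (val s) 1%g by exact: semilattice_le1.
pose chi := filter_character Ps1 (fun t u => semilattice_glb t u (val s)).
have chiE t : chi t = 1%g <-> semilattice_le (val s) t by exact: filter_characterE.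
have := congr1 (fun F : A => F chi) x0.
rewrite evaluation_val (bigD1_seq (val s)) /=; [|exact: valP|exact: fset_uniq].
rewrite (chiE _).2; last exact: semilattice_le_refl.
rewrite big_seq_cond big1 => [|t /andP[tx ts]].
  rewrite addr0 mulr1 => /eqP; rewrite -[_ == _]/(_ == 0).
  by move/eqP => H; have := valP s; rewrite -mcoeff_neq0 H eqxx.
have [/chiE/eqP st|->] := discrete_dual_val_cases chi t; last by rewrite mulr0.
by have := s_maximal [` tx]%fset st => E; rewrite -E eqxx in ts.
Qed.

Lemma evaluation_surjective F : exists x, F = evaluation x.
Proof.
have l := evaluation_linear.
suff [x xE] : [set f : D -> k^o | exists x, f = evaluation x] F.
  by exists x; apply: rep_eq => chi; rewrite xE.
apply: (@span_sub k (D -> k^o) (@characters k D)); last first.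
- exact: representative_span_character discrete_dual_mulC discrete_dual_mul_idem _ (repP F).
- move=> f /character_is_evaluation[s sE]; exists (msingle k s).
  by rewrite evaluationE; apply/funext => chi; rewrite sE.
- split; first by exists 0; rewrite (lin0 l).
  by move=> a _ _ [x ->] [y ->]; exists (a *: x + y); rewrite l.
Qed.

Lemma evaluation_bijective : bijective evaluation.
Proof.
have [g gE] := choice evaluation_surjective.
exists g => [x|F]; last by rewrite -gE.
by apply: evaluation_injective; rewrite -gE.
Qed.

Lemma evaluation_isomorphism : bialgebra_isomorphic kS A.
Proof.
exists evaluation; split.
- exact: evaluation_linear.
- exact: evaluation_monoid_morphism.
- exact: evaluation_bijective.
- exact: evaluation_comul.
- exact: evaluation_counit.
Qed.

End DiscreteDualSemilattice.

(** * Isomorphisms of bialgebras and the zero biideal *)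

Section Isomorphisms.
Variable k : fieldType.
Implicit Types A B C : bialgType k.

Lemma tmap_id (V W : lmodType k) (t : tensor V W) : tmap id id t = t.
Proof.
move: t; apply: tensor_linear_eq => // [|v w]; last by rewrite tmap_tens.
by apply: tmap_linear.
Qed.

Lemma bialgebra_isomorphic_sym A B :
  bialgebra_isomorphic A B -> bialgebra_isomorphic B A.
Proof.
move=> [f [lf [f1 fM] [g fK gK] fD fe]]; exists g.
have lg : linear g.
  by move=> a x y; apply: (can_inj fK); rewrite lf !gK.
split=> //; last 2 first.
- move=> b; rewrite -[in RHS](gK b) fD tmap_comp //.
  by rewrite (_ : g \o f = id) ?tmap_id //; exact/funext.
- by move=> b; rewrite -fe gK.
- split; first by rewrite -f1 fK.
  by move=> x y; apply: (can_inj fK); rewrite fM !gK.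
- by exists f.
Qed.

Lemma bialgebra_isomorphic_trans A B C :
  bialgebra_isomorphic A B -> bialgebra_isomorphic B C ->
  bialgebra_isomorphic A C.
Proof.
move=> [f [lf [f1 fM] bf fD fe]] [g [lg [g1 gM] bg gD ge]].
exists (g \o f); split.
- exact: comp_linear.
- by split=> [|x y] /=; rewrite ?f1 ?g1 // fM gM.
- exact: bij_comp.
- by move=> a /=; rewrite gD fD tmap_comp.
- by move=> a /=; rewrite ge fe.
Qed.

Lemma zero_biideal_ideal A : is_ideal (fun x : A => x = 0).
Proof.
split; first by split=> // a u v -> ->; rewrite scaler0 addr0.
by move=> a x ->; rewrite mulr0 mul0r.
Qed.

Lemma zero_biideal_coideal A : is_coideal (fun x : A => x = 0).
Proof.
split; first exact: (zero_biideal_ideal A).1.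
- move=> x ->; rewrite (lin0 comul_linear).
  exact: (span_subspace _).1.
- by move=> x ->; exact: (lin0 (V := k^o) counit_linear).
Qed.

Definition zero_biideal A : biideal A :=
  Biideal (zero_biideal_ideal A) (zero_biideal_coideal A).

Lemma quotient_zero_biideal A :
  bialgebra_isomorphic A (quotient_bialgebra (zero_biideal A)).
Proof.
exists (@bproj k A (zero_biideal A)); split.
- exact: bproj_linear.
- by split=> // x y; exact: bprojM.
- exists (@brepr k A (zero_biideal A)) => [x|]; last exact: breprK.
  by apply/eqP; rewrite -subr_eq0; apply/eqP; exact: (brepr_sub (zero_biideal A)).
- by move=> a; exact: bcomulE.
- by move=> a; exact: bcounitE.
Qed.

End Isomorphisms.

Theorem theorem3p14 (R : realType) (S : boundedSemilatticeType) :
  (exists I : biideal (monoid_algebra R[i] S),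
     bialgebra_isomorphic (Rep R[i] (discrete_dual R[i] S))
                          (quotient_bialgebra I))
  /\ (finite_set [set: S] ->
       bialgebra_isomorphic (Rep R[i] (discrete_dual R[i] S))
                            (monoid_algebra R[i] S)).
Proof.
have iso := bialgebra_isomorphic_sym (evaluation_isomorphism R[i] S).
split=> //; exists (zero_biideal _).
exact: bialgebra_isomorphic_trans iso (quotient_zero_biideal _).
Qed.
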